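(* Let $\kappa$ be a regular uncountable cardinal and $\lambda>\kappa$ a cardinal. The following are equivalent: (i) $\kappa$ is weakly compact and $\lambda^{<\kappa}<\mathbf{cov}(\mathbf{M}_{\kappa,\kappa})$. (ii) $I_{\kappa,\lambda}^+\xrightarrow{\kappa}(I_{\kappa,\lambda}^+)^2$. (iii) $I_{\kappa,\lambda}^+\xrightarrow[\kappa]{\kappa}(I_{\kappa,\lambda}^+;\kappa)^2$.
   Context: For a cardinal $\mu$ and a set $A$, $P_\mu(A)=\{a\subseteq A:|a|<\mu\}$. $I_{\kappa,\lambda}$ is the set of all $A\subseteq P_\kappa(\lambda)$ such that $A\cap\{b\in P_\kappa(\lambda):a\subseteq b\}=\emptyset$ for some $a\in P_\kappa(\lambda)$; it is an ideal on $P_\kappa(\lambda)$. For an ideal $H$ on $P_\kappa(\lambda)$, $H^+$ is the set of subsets of $P_\kappa(\lambda)$ not in $H$. $\kappa$ is weakly compact if for every $f:\{(\xi,\eta)\in\kappa\times\kappa:\xi<\eta\}\to2$ there is $A\subseteq\kappa$ of order type $\kappa$ such that $f$ is constant on $\{(\xi,\eta)\in A\times A:\xi<\eta\}$. For $A\subseteq P_\kappa(\lambda)$, $[A]^2_\kappa=\{(\bigcup(a\cap\kappa),b):a,b\in A,\ \bigcup(a\cap\kappa)<\bigcup(b\cap\kappa)\}$ and $[A]^2_{\kappa,\kappa}=\{(\bigcup(a\cap\kappa),\bigcup(b\cap\kappa)):a,b\in A,\ \bigcup(a\cap\kappa)<\bigcup(b\cap\kappa)\}$. $H^+\xrightarrow{\kappa}(H^+)^2$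 means: for every $F:[P_\kappa(\lambda)]^2_\kappa\to2$ and every $A\in H^+$ there is $B\in H^+\cap P(A)$ such that $F$ is constant on $[B]^2_\kappa$. For an ordinal $\alpha$, $H^+\xrightarrow[\kappa]{\kappa}(H^+;\alpha)^2$ means: for every $F:[P_\kappa(\lambda)]^2_{\kappa,\kappa}\to2$ and every $A\in H^+$ there is $B\subseteq A$ such that either $B\in H^+$ and $F$ is identically $0$ on $[B]^2_{\kappa,\kappa}$, or $\{\bigcup(a\cap\kappa):a\in B\}$ has order type $\alpha$ and $F$ is identically $1$ on $[B]^2_{\kappa,\kappa}$. $\mathbf{cov}(\mathbf{M}_{\kappa,\kappa})$: give ${}^\kappa2$ the topology whose basic open sets are $\emptyset$ and $O_s=\{f\in{}^\kappa2:s\subseteq f\}$ for $s\in\bigcup\{{}^a2:a\in P_\kappa(\kappa)\}$. $\mathbf{M}_{\kappa,\kappa}$ is the set of all $W\subseteq{}^\kappa2$ such that $W\cap\bigcap X=\emptyset$ for some collection $X$ of dense open sets with $0<|X|\le\kappa$. $\mathbf{cov}(\mathbf{M}_{\kappa,\kappa})$ is the least cardinality of a $Y\subseteq\mathbf{M}_{\kappa,\kappa}$ with $\bigcup Y={}^\kappa2$. *)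

(* Defs.v *)
From mathcomp Require Import all_boot all_order.
From mathcomp Require Import mathcomp_extra boolp classical_sets functions cardinality wochoice.

Set Implicit Arguments.
Unset Strict Implicit.
Unset Printing Implicit Defensive.

Import Order.TTheory.
Local Open Scope classical_set_scope.
Local Open Scope card_scope.
Local Open Scope order_scope.

Definition card_lt T U (A : set T) (B : set U) : Prop :=
  A #<= B /\ ~ (B #<= A).
Notation "A '#<' B" := (card_lt A B) (at level 79) : card_scope.

(* Ordinals are the elements of an arbitrary well-ordered type On; an ordinal
   k is identified, as a set, with the set [below k] of its predecessors.
   Nothing bounds On, so every pair of cardinals kappa < lambda occurs. *)
Section Ordinals.
Context {d : Order.disp_t} {On : orderType d}.
Implicit Types (k l x y u : On) (a b A : set On).

Definition below k : set On := [set x | x < k].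

Definition is_cardinal k : Prop := forall x, x < k -> below x #< below k.

Definition cofinal A k : Prop :=
  A `<=` below k /\ forall x, x < k -> exists2 y, A y & x <= y.

Definition regular_cardinal k : Prop :=
  [/\ is_cardinal k, infinite_set (below k)
    & forall A, cofinal A k -> ~ (A #< below k)].

Definition has_order_type A u : Prop :=
  exists f : On -> On,
    f @` below u = A /\ {in below u &, {homo f : x y / x < y}}.

(* The ordinal \bigcup a of a set a of ordinals; the default value u0 is only
   used when On contains no such ordinal. *)
Definition union_ord u0 a : On :=
  xget u0 [set u | below u = \bigcup_(x in a) below x].

(* P_k(A), for A a set of ordinals. *)
Definition Pset k A : set (set On) := [set a | a `<=` A /\ a #< below k].

Definition Pkl k l : set (set On) := Pset k (below l).

Definition ideal_I k l : set (set (set On)) :=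
  [set A : set (set On) | A `<=` Pkl k l /\
     exists2 a, Pkl k l a & A `&` [set b | Pkl k l b /\ a `<=` b] = set0].

Definition positive k l (H : set (set (set On))) : set (set (set On)) :=
  [set A : set (set On) | A `<=` Pkl k l /\ ~ H A].

(* \bigcup (a \cap k) *)
Definition trace k a : On := union_ord k (a `&` below k).

(* Colourings are given as total functions; only their values on the relevant
   set of pairs are ever used. *)
Definition weakly_compact k : Prop :=
  forall f : On -> On -> bool,
  exists A, [/\ A `<=` below k, has_order_type A k
    & exists c, forall x y, A x -> A y -> x < y -> f x y = c].

Definition pairs_k k (B : set (set On)) : set (On * set On) :=
  [set p | exists a b,
     [/\ B a, B b, trace k a < trace k b & p = (trace k a, b)]].

Definition pairs_kk k (B : set (set On)) : set (On * On) :=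
  [set p | exists a b,
     [/\ B a, B b, trace k a < trace k b & p = (trace k a, trace k b)]].

Definition arrow_k k l (H : set (set (set On))) : Prop :=
  forall (F : On * set On -> bool) (A : set (set On)), positive k l H A ->
  exists B, [/\ positive k l H B, B `<=` A
    & exists c, forall p, pairs_k k B p -> F p = c].

Definition arrow_kk k l (H : set (set (set On))) (alpha : On) : Prop :=
  forall (F : On * On -> bool) (A : set (set On)), positive k l H A ->
  exists B, B `<=` A /\
    ((positive k l H B /\ forall p, pairs_kk k B p -> F p = false) \/
     (has_order_type (trace k @` B) alpha /\
        forall p, pairs_kk k B p -> F p = true)).

(* The set of functions from k to 2. *)
Definition two_pow k : Type := below k -> bool.

Definition O_ k a (s : a -> bool) : set (two_pow k) :=
  [set f | forall (x : below k) (y : a), val x = val y -> f x = s y].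

Definition basic_open k : set (set (two_pow k)) :=
  [set U | U = set0 \/
     exists2 a, Pset k (below k) a & exists s : a -> bool, U = O_ s].

Definition open_kk k : set (set (two_pow k)) :=
  [set U | exists2 X, X `<=` @basic_open k & U = \bigcup_(V in X) V].

Definition dense_kk k : set (set (two_pow k)) :=
  [set D | forall U, open_kk U -> U !=set0 -> D `&` U !=set0].

Definition meager_kk k : set (set (two_pow k)) :=
  [set W | exists X : set (set (two_pow k)),
     [/\ X `<=` @open_kk k `&` @dense_kk k, X !=set0, X #<= below k
       & W `&` \bigcap_(U in X) U = set0]].

Definition meager_cover k (Y : set (set (two_pow k))) : Prop :=
  Y `<=` @meager_kk k /\ \bigcup_(W in Y) W = setT.

(* Cardinals of sets that need not embed in On are given by representatives:
   cov(M_{k,k}) is the cardinality of any Y satisfying [realizes_cov]. *)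
Definition realizes_cov k (Y : set (set (two_pow k))) : Prop :=
  meager_cover Y /\ forall Y', @meager_cover k Y' -> Y #<= Y'.

(* l^{<k} is the cardinality of the set of sequences of length less than k
   with values in l. *)
Definition lt_pow l k : Type := {u : below k & below (val u) -> below l}.

Definition lt_pow_lt_cov l k : Prop :=
  exists Y : set (set (two_pow k)),
    realizes_cov Y /\ [set: lt_pow l k] #< Y.

(* trace k a is a genuine union, lying below k, on P_k(l). *)
Lemma below_trace k l a : well_order (<=%O : rel On) -> regular_cardinal k ->
  Pkl k l a ->
  below (trace k a) = \bigcup_(x in a `&` below k) below x /\ trace k a < k.
Proof.
move=> wo [_ _ reg] [_ [le_ak nle_ka]].
set A := a `&` below k; set S := \bigcup_(x in A) below x.
have ltA : A #< below k.
  have le_Aa : A #<= a by apply: subset_card_le => x [].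
  split; first exact: card_le_trans le_Aa le_ak.
  by move=> le_kA; apply: nle_ka; exact: card_le_trans le_kA le_Aa.
have [x ltxk Ax] : exists2 x, x < k & forall y, A y -> y < x.
  apply: contrapT => nb; apply: (reg A _ ltA); split=> [y []//|x ltxk].
  apply: contrapT => nx; apply: nb; exists x => // y Ay.
  by rewrite ltNge; apply/negP => lexy; apply: nx; exists y.
have [u [[uS umin] _]] : exists! z, minimum_of <=%O [pred z | `[< forall y, A y -> y <= z >]] z.
  by apply: wo; exists x; apply/asboolP => y /Ax; exact: ltW.
move/asboolP: uS => uS.
have uE : below u = S.
  apply/seteqP; split=> [z ltzu | z [y Ay ltzy]]; last exact: lt_le_trans ltzy (uS y Ay).
  apply: contrapT => nz; suff : u <= z by rewrite leNgt ltzu.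
  apply: umin; apply/asboolP => y Ay.
  by rewrite leNgt; apply/negP => ltzy; apply: nz; exists y.
have tS : below (trace k a) = S by apply: (@xgetPex _ k [set v | below v = S]); exists u.
split=> //; apply: le_lt_trans ltxk; rewrite leNgt; apply/negP => ltxt.
have : S x by rewrite -tS.
by case=> y Ay; rewrite /below /= ltNge (ltW (Ax y Ay)).
Qed.

End Ordinals.

(* Main.v *)
(* If kappa is weakly compact, every kappa-sequence in 2^kappa has a lexicographically
   monotone subsequence, which converges pointwise; in particular kappa is a strong
   limit.

   From (i): every function F(., b) is a point of 2^(trace b), and weak compactness
   yields h in 2^kappa such that, for each xi < kappa, F(., b) agrees with h below xi
   for positively many b in A.  The sets x of traces for which some b in A above a
   has trace b in x and F(., b) = h on the part of x below trace b form a dense open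
   set, for each of the lambda^(<kappa) many a in P_kappa(lambda); a point common to
   all of them gives a positive B on which F(xi, b) = h(xi), and B splits according
   to the value of h at the trace.

   From (iii): given lambda^(<kappa) many meager sets, index them by the small
   subsets c of lambda \ kappa.  Code triples (al, be, s), where s in 2^[al, be), by
   the ordinals below kappa, and take for A the set of those b whose trace codes a
   block s forcing the first al dense open sets of each c included in b \ kappa,
   whatever precedes al.  One colouring shows that block lengths can be bounded by a
   single function g (otherwise decreasing pairs (al, be) give a counterexample); a
   second colouring, of overlapping blocks, then produces a positive set of pairwise
   disjoint blocks, whose union avoids every one of the meager sets. *)
Require Import Defs.
From mathcomp Require Import all_boot all_order.
From mathcomp Require Import boolp classical_sets functions cardinality wochoice.

Set Implicit Arguments.
Unset Strict Implicit.
Unset Printing Implicit Defensive.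

Import Order.TTheory.
Local Open Scope order_scope.
Local Open Scope classical_set_scope.
Local Open Scope card_scope.

(** * Comparing cardinalities *)

Definition some_of T (x0 : T) (A : set T) : T :=
  if pselect (A !=set0) is left h then projT1 (cid h) else x0.

Lemma some_ofP T (x0 : T) (A : set T) : A !=set0 -> A (some_of x0 A).
Proof. by rewrite /some_of; case: pselect => // h _; case: (cid h). Qed.

Section Cardinality.

Lemma card_le_inj T U (u0 : U) (A : set T) (B : set U) : A #<= B ->
  exists f : T -> U, (forall x, A x -> B (f x)) /\
    (forall x y, A x -> A y -> f x = f y -> x = y).
Proof.
move=> /card_leP[g]; have [A0|/set0P nA0] := eqVneq A set0.
  by exists (fun=> u0); rewrite A0.
exists (fun x => if pselect (A x) is left h then val (g (exist _ x (mem_set h))) else u0).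
split=> [x Ax | x y Ax Ay].
  by case: pselect => // h; apply: set_mem; exact: valP.
case: pselect => // hx; case: pselect => // hy /val_inj gxy.
have /(_ _ _ gxy) : forall u v, g u = g v -> u = v.
  by move=> u v; apply: (@inj _ _ [set: A] g); rewrite inE.
by move/(congr1 val).
Qed.

Lemma inj_card_le_fun T U (A : set T) (B : set U) (f : T -> U) :
  (forall x, A x -> B (f x)) ->
  (forall x y, A x -> A y -> f x = f y -> x = y) -> A #<= B.
Proof.
move=> fAB finj; apply: card_le_trans (_ : f @` A #<= B); last first.
  by apply: subset_card_le => _ [x Ax <-]; exact: fAB.
have /(inj_card_eq) : {in A &, injective f}.
  by move=> x y /set_mem Ax /set_mem Ay; exact: finj.
by rewrite card_eq_sym card_eq_le => /andP[].
Qed.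

Lemma card_le_surj T U (u0 : U) (A : set T) (B : set U) : B !=set0 -> B #<= A ->
  exists f : T -> U, f @` A = B.
Proof.
move=> [b0 Bb0] leBA.
have [A0|/set0P[a0 Aa0]] := eqVneq A set0.
  move: leBA; rewrite A0 => /card_le0P B0; by rewrite B0 in Bb0.
have [g [gA ginj]] := card_le_inj a0 leBA.
(* On the range of [g] this set is the preimage of [x]; elsewhere it is all of [B], where any value
   will do. *)
exists (fun x => some_of b0 [set y | B y /\ (g y = x \/ forall z, B z -> g z <> x)]).
have K x : B !=set0 -> [set y | B y /\ (g y = x \/ forall z, B z -> g z <> x)] !=set0.
  move=> [z Bz]; have [[y By gy]|n] := pselect (exists2 y, B y & g y = x).
    by exists y; split=> //; left.
  by exists z; split=> //; right=> w Bw gw; apply: n; exists w.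
apply/seteqP; split=> [_ [x Ax <-]|y By].
  by have [] := @some_ofP _ b0 _ (K x (ex_intro _ _ Bb0)).
exists (g y); first exact: gA.
by have [Bz [/ginj|/(_ y By)//]] := @some_ofP _ b0 _ (K (g y) (ex_intro _ _ Bb0)); apply.
Qed.

(** Zorn's lemma gives a maximal graph [G] of a partial injection; if it missed a point on each
    side, that pair could be added. *)
Lemma card_le_total T U (A : set T) (B : set U) : A #<= B \/ B #<= A.
Proof.
pose P (G : set (T * U)) := [/\ forall p, G p -> A p.1 /\ B p.2,
  forall p q, G p -> G q -> p.1 = q.1 -> p.2 = q.2
  & forall p q, G p -> G q -> p.2 = q.2 -> p.1 = q.1].
have [|G [[GAB Gfun Ginj] Gmax]] := @Zorn_bigcup _ P.
  move=> F FP Ft; split.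
  - by move=> p [G FG Gp]; have [h _ _] := FP _ FG; exact: h.
  - move=> p q [G FG Gp] [G' FG' Gq]; have [_ h _] := FP _ FG; have [_ h' _] := FP _ FG'.
    by have [s|s] := Ft _ _ FG FG'; [apply: h'|apply: h] => //; exact: s.
  - move=> p q [G FG Gp] [G' FG' Gq]; have [_ _ h] := FP _ FG; have [_ _ h'] := FP _ FG'.
    by have [s|s] := Ft _ _ FG FG'; [apply: h'|apply: h] => //; exact: s.
have [AG|nAG] := pselect (forall x, A x -> exists y, G (x, y)).
  left; have [A0|/set0P[x0 /AG[u0 _]]] := eqVneq A set0; first by rewrite A0.
  apply: (@inj_card_le_fun _ _ _ _ (fun x => some_of u0 [set y | G (x, y)])).
    by move=> x /AG/(@some_ofP _ u0)/GAB[].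
  by move=> x x' /AG/(@some_ofP _ u0) h /AG/(@some_ofP _ u0) h' e; exact: (Ginj _ _ h h').
have [BG|nBG] := pselect (forall y, B y -> exists x, G (x, y)).
  right; have [B0|/set0P[y0 /BG[u0 _]]] := eqVneq B set0; first by rewrite B0.
  apply: (@inj_card_le_fun _ _ _ _ (fun y => some_of u0 [set x | G (x, y)])).
    by move=> y /BG/(@some_ofP _ u0)/GAB[].
  by move=> y y' /BG/(@some_ofP _ u0) h /BG/(@some_ofP _ u0) h' e; exact: (Gfun _ _ h h').
move/existsNP: nAG => [x /not_implyP[Ax nx]].
move/existsNP: nBG => [y /not_implyP[By ny]].
exfalso; apply: (Gmax (G `|` [set (x, y)])).
  split; first by move=> p Gp; left.
  by move=> h; apply: nx; exists y; apply: h; right.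
split.
- by move=> p [/GAB//|->].
- move=> p q [Gp|->] [Gq|->] //=; first exact: Gfun.
    by move=> e; case: nx; exists p.2; rewrite -e -surjective_pairing.
  by move=> e; case: nx; exists q.2; rewrite e -surjective_pairing.
- move=> p q [Gp|->] [Gq|->] //=; first exact: Ginj.
    by move=> e; case: ny; exists p.1; rewrite -e -surjective_pairing.
  by move=> e; case: ny; exists q.1; rewrite e -surjective_pairing.
Qed.

Lemma card_ltNge T U (A : set T) (B : set U) : (A #< B) <-> ~ (B #<= A).
Proof.
split=> [[]//|n]; split=> //.
by have [|//] := card_le_total A B.
Qed.

(* Hönig: a maximal family of injective simultaneous choices is onto some member. *)
Lemma card_min T (C : set (set T)) : C !=set0 ->
  exists2 Y, C Y & forall Y', C Y' -> Y #<= Y'.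
Proof.
move=> [Y0 CY0].
pose P (Z : set (set T -> T)) := forall f, Z f -> forall Y, C Y ->
  Y (f Y) /\ forall g, Z g -> f Y = g Y -> f = g.
have [|Z [PZ Zmax]] := @Zorn_bigcup _ P.
  move=> F FP Ft f [Z FZ Zf] Y CY; split.
    by have [] := FP _ FZ _ Zf _ CY.
  move=> g [Z' FZ' Zg].
  have [s|s] := Ft _ _ FZ FZ'.
    have [_] := FP _ FZ' _ (s _ Zf) _ CY; exact.
  have [_] := FP _ FZ _ Zf _ CY; apply; exact: s.
have [[Y CY YZ]|nY] := pselect (exists2 Y, C Y & forall y, Y y -> exists f, Z f /\ f Y = y).
  exists Y => // Y' CY'; have [->//|/set0P[y0 Yy0]] := eqVneq Y set0.
  have [f0 _] := YZ _ Yy0.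
  apply: (@inj_card_le_fun _ _ _ _ (fun y => some_of f0 [set f | Z f /\ f Y = y] Y')).
    by move=> y /YZ/(@some_ofP _ f0)[/PZ/(_ _ CY')[]].
  move=> y y' /YZ/(@some_ofP _ f0)[Zg e] /YZ/(@some_ofP _ f0)[Zg' e'].
  by have [_ /(_ _ Zg') h] := PZ _ Zg _ CY' => /h h'; rewrite -e h' e'.
exfalso.
(* Otherwise each [Y] in [C] has a point that no member of [Z] takes there; these points form one
   more choice function, against maximality. *)
have {nY}H Y : exists y, C Y -> Y y /\ forall f, Z f -> f Y <> y.
  have [CY|nCY] := pselect (C Y); last first.
    have [[y _]|n] := pselect (Y0 !=set0); first by exists y.
    by exfalso; apply: nY; exists Y0 => // y Yy; case: n; exists y.
  apply: contrapT => n; apply: nY; exists Y => // y Yy; apply: contrapT => n'.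
  by apply: n; exists y => _; split=> // f Zf fY; apply: n'; exists f; split.
have [g gP] := choice H.
apply: (Zmax (Z `|` [set g])).
  split; first by move=> f; left.
  by move=> h; have [_ /(_ g (h g (or_intror erefl)))] := gP _ CY0.
move=> f [Zf|->] Y CY.
  have [Yf fP] := PZ _ Zf _ CY; split=> // h [Zh|->]; first exact: fP.
  by have [_ /(_ _ Zf)] := gP _ CY.
have [Yg gZ] := gP _ CY; split=> // h [Zh|->] // e.
by case: (gZ _ Zh); rewrite e.
Qed.

(** Hilbert's hotel: [x] goes to the first term of a sequence [g] in [A], each term moves to the
    next, all else stays. *)
Lemma infinite_setU1_le T (A : set T) (x : T) : infinite_set A -> A `|` [set x] #<= A.
Proof.
move=> /infiniteP leA; have [Ax|nAx] := pselect (A x).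
  by apply: subset_card_le => y [//|->].
have [g [gA ginj]] := card_le_inj x leA.
have gI m n : g m = g n -> m = n by exact: ginj.
pose f y := if `[< y = x >] then g 0%N else
  if pselect (exists n, g n = y) is left h then g (projT1 (cid h)).+1 else y.
have f1 : f x = g 0%N by rewrite /f asboolT.
have f2 n : f (g n) = g n.+1.
  rewrite /f asboolF; last by move=> e; apply: nAx; rewrite -e; exact: gA.
  case: pselect => [h|[]]; last by exists n.
  by case: cid => m /= /gI ->.
have f3 y : y <> x -> ~ (exists n, g n = y) -> f y = y.
  by move=> yx ny; rewrite /f asboolF//; case: pselect.
have fA y : A y -> A (f y).
  move=> Ay; have [[n <-]|ny] := pselect (exists n, g n = y); first by rewrite f2; exact: gA.
  by rewrite f3// => e; rewrite e in Ay.
apply: (@inj_card_le_fun _ _ _ _ f).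
  by move=> y [Ay|->]; [exact: fA|rewrite f1; exact: gA].
have K y : (A `|` [set x]) y ->
    [\/ y = x, exists n, y = g n | [/\ f y = y, A y & ~ (exists n, g n = y)]].
  move=> [Ay|->]; last by constructor 1.
  have [[n <-]|ny] := pselect (exists n, g n = y); first by constructor 2; exists n.
  by constructor 3; split=> //; apply: f3 => // e; rewrite e in Ay.
move=> y z /K[->|[n ->]|[fy Ay ny]] /K[->|[m ->]|[fz Az nz]]; rewrite ?f1 ?f2 ?fy ?fz //.
- by move/gI.
- by move=> e; case: nz; exists 0%N.
- by move/gI.
- by move/gI => [->].
- by move=> e; case: nz; exists n.+1.
- by move=> e; case: ny; exists 0%N.
- by move=> e; case: ny; exists m.+1.
Qed.

Lemma card_le_setX T1 U1 T2 U2 (A1 : set T1) (B1 : set U1) (A2 : set T2) (B2 : set U2) :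
  A1 #<= B1 -> A2 #<= B2 -> A1 `*` A2 #<= B1 `*` B2.
Proof.
have [->|/set0P[x1 Ax1]] := eqVneq A1 set0; first by rewrite set0X.
have [->|/set0P[x2 Ax2]] := eqVneq A2 set0; first by rewrite setX0.
have [->|/set0P[u1 _]] := eqVneq B1 set0.
  by move=> /card_le0P A10; rewrite A10 in Ax1.
have [->|/set0P[u2 _]] := eqVneq B2 set0.
  by move=> _ /card_le0P A20; rewrite A20 in Ax2.
move=> /(card_le_inj u1)[f [fB fI]] /(card_le_inj u2)[g [gB gI]].
apply: (@inj_card_le_fun _ _ _ _ (fun p => (f p.1, g p.2))).
  by move=> p [/= h1 h2]; split; [exact: fB|exact: gB].
by move=> [a b] [c e] [/= a1 b1] [/= c1 e1] [/fI-> // /gI->].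
Qed.

End Cardinality.

(** * Well-ordered types *)

Lemma wf_rec W (R : W -> W -> Prop) U (H : forall p, (forall q, R q p -> U) -> U) :
  well_founded R -> exists f : W -> U, forall p, f p = H p (fun q _ => f q).
Proof.
move=> wf; exists (Fix wf (fun=> U) H) => p.
rewrite Fix_eq// => x f g fg; congr (H x).
by apply: functional_extensionality_dep => q; apply: functional_extensionality_dep.
Qed.

Lemma segments_card_le W (R : W -> W -> Prop) U (A : set W) (B : set U) :
  well_founded R -> (forall p q, [\/ R p q, p = q | R q p]) ->
  (forall p, A p -> ~ (B #<= [set q | A q /\ R q p])) -> A #<= B.
Proof.
move=> wf tri seg; have [->//|/set0P[p0 Ap0]] := eqVneq A set0.
have [B0|/set0P[u0 _]] := eqVneq B set0; first by case: (seg _ Ap0); rewrite B0.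
have [f fE] := @wf_rec W R U
  (fun p rec => some_of u0 [set u | B u /\ forall q (h : R q p), A q -> rec q h <> u]) wf.
have fP p : A p -> B (f p) /\ forall q, R q p -> A q -> f q <> f p.
  move=> Ap; rewrite fE.
  apply: (@some_ofP _ u0 [set u | B u /\ forall q, R q p -> A q -> f q <> u]).
  apply: contrapT => n; apply: (seg _ Ap).
  apply: card_le_trans (card_image_le f _); apply: subset_card_le => u Bu.
  apply: contrapT => nu; apply: n; exists u; split=> // q Rqp Aq fqu.
  by apply: nu; exists q.
apply: (@inj_card_le_fun _ _ _ _ f) => [p /fP[]//|p q Ap Aq fpq].
have [Rpq|//|Rqp] := tri p q.
  by have [_ /(_ p Rpq Ap)] := fP _ Aq.
by have [_ /(_ q Rqp Aq)[]] := fP _ Ap.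
Qed.

Section Ordinals.
Context {d : Order.disp_t} {On : orderType d}.
Context (On_wo : well_order (<=%O : rel On)).
Implicit Types (k l x y z u : On).

Lemma least (A : set On) : A !=set0 -> exists2 m, A m & forall x, A x -> m <= x.
Proof.
move=> [x Ax]; have [|m [[mA mmin] _]] := On_wo (A := [pred z | `[< A z >]]).
  by exists x; exact/asboolP.
by exists m; [exact/asboolP|move=> y Ay; apply: mmin; exact/asboolP].
Qed.

Lemma lt_wf : well_founded (fun x y : On => x < y).
Proof.
move=> x; apply: contrapT => nx.
have [m nm mmin] := @least [set x | ~ Acc (fun x y : On => x < y) x] (ex_intro _ x nx).
apply: nm; constructor=> y ltym; apply: contrapT => ny.
by have := mmin _ ny; rewrite leNgt ltym.
Qed.

Lemma card_ltW k x : is_cardinal k -> x < k -> ~ (below k #<= below x).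
Proof. by move=> ck xk; have [] := ck _ xk. Qed.

Lemma below_sub x y : x <= y -> below x `<=` below y.
Proof. by move=> xy z /lt_le_trans; apply. Qed.

(** Gödel's well-ordering of pairs: by maximum, then lexicographically. *)
Definition pair_lt (p q : On * On) : Prop :=
  let mp := Order.max p.1 p.2 in let mq := Order.max q.1 q.2 in
  mp < mq \/ mp = mq /\ (p.1 < q.1 \/ p.1 = q.1 /\ p.2 < q.2).

Lemma pair_lt_wf : well_founded pair_lt.
Proof.
suff H m a b : Order.max a b = m -> Acc pair_lt (a, b) by case=> a b; exact: H erefl.
elim/(well_founded_ind lt_wf): m a b => m IHm a.
elim/(well_founded_ind lt_wf): a => a IHa b.
elim/(well_founded_ind lt_wf): b => b IHb mE.
constructor=> -[a' b'] [/=|[/= e [lt|[e' lt]]]].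
- by rewrite mE => /IHm; apply.
- by apply: IHa => //; rewrite e.
- by rewrite e' in e *; apply: IHb => //; rewrite e.
Qed.

Lemma pair_lt_tri p q : [\/ pair_lt p q, p = q | pair_lt q p].
Proof.
case: p q => a b [a' b']; rewrite /pair_lt /=.
have [lt|lt|e] := ltgtP (Order.max a b) (Order.max a' b').
- by constructor 1; left.
- by constructor 3; left.
have [lt|lt|ea] := ltgtP a a'.
- by constructor 1; right; split=> //; left.
- by constructor 3; right; split=> //; left.
have [lt|lt|eb] := ltgtP b b'.
- by constructor 1; right; split=> //; right.
- by constructor 3; right; split=> //; right.
by constructor 2; rewrite ea eb.
Qed.

Lemma card_ordinal x : infinite_set (below x) ->
  exists u, [/\ u <= x, is_cardinal u, infinite_set (below u) & below x #<= below u].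
Proof.
move=> ix.
have [u leu umin] := @least [set u | below x #<= below u] (ex_intro _ x (card_lexx _)).
exists u; split=> //; first by apply: umin; exact: card_lexx.
  move=> y yu; apply/card_ltNge => le.
  by have := umin y (card_le_trans leu le); rewrite leNgt yu.
by move=> /(card_le_finite leu).
Qed.

(** Hessenberg's theorem: the predecessors of a pair with maximum [m] lie in the square of [S],
    which is finite or, by induction at the cardinality of [m], no larger than [m]. *)
Lemma card_square_le k : is_cardinal k -> infinite_set (below k) ->
  below k `*` below k #<= below k.
Proof.
elim/(well_founded_ind lt_wf): k => k IH ck ik.
apply: (segments_card_le pair_lt_wf pair_lt_tri) => -[x y] [/= xk yk].
set m := Order.max x y; have mk : m < k by rewrite /m gt_max; apply/andP.
pose S := below m `|` [set m].
move=> le; have {le} : below k #<= S `*` S.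
  apply: card_le_trans le _; apply: subset_card_le => -[a b] [_ pl].
  have : Order.max a b <= m.
    by case: pl => [/ltW//|[-> _]].
  by rewrite ge_max => /andP[am bm]; split; rewrite /S/= ; [move: am|move: bm];
    rewrite le_eqVlt => /orP[/eqP->|]; [right|left|right|left].
have [fin|inf] := pselect (finite_set (below m)).
  move=> /card_le_finite; apply: contra_not ik => h; apply: h.
  by apply: finite_setX; rewrite finite_setU; split=> //; exact: finite_set1.
move=> le; have leS : S #<= below m by exact: infinite_setU1_le.
have [u [um cu iu leu]] := card_ordinal inf.
have leSu : S #<= below u := card_le_trans leS leu.
apply: (card_ltW ck mk); apply: card_le_trans le _.
apply: card_le_trans (card_le_setX leSu leSu) _.
apply: card_le_trans (IH _ (le_lt_trans um mk) cu iu) _.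
exact/subset_card_le/below_sub.
Qed.
End Ordinals.

(** * Sets of size less than a regular cardinal *)

Section Small.
Context {d : Order.disp_t} {On : orderType d}.
Context (On_wo : well_order (<=%O : rel On)).
Context (k : On).
Context (k_reg : regular_cardinal k).

Definition small T (A : set T) : Prop := A #< below k.

Definition unbounded (S : set On) : Prop := forall x, x < k -> exists2 y, S y & x <= y.

Lemma smallP T (A : set T) : small A <-> ~ (below k #<= A).
Proof. exact: card_ltNge. Qed.

Lemma small_le T U (A : set T) (B : set U) : A #<= B -> small B -> small A.
Proof. by move=> AB /smallP sB; apply/smallP => /card_le_trans/(_ AB). Qed.

Lemma small_sub T (A B : set T) : A `<=` B -> small B -> small A.
Proof. by move=> AB; exact/small_le/subset_card_le. Qed.

Lemma small_image T U (f : T -> U) (A : set T) : small A -> small (f @` A).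
Proof. exact/small_le/card_image_le. Qed.

Lemma small_inj T U (f : T -> U) (A : set T) (B : set U) :
  (forall x, A x -> B (f x)) -> (forall x y, A x -> A y -> f x = f y -> x = y) ->
  small B -> small A.
Proof. by move=> fAB finj; exact/small_le/(inj_card_le_fun fAB finj). Qed.

Lemma small_below x : x < k -> small (below x).
Proof. by case: k_reg => + _ _; apply. Qed.

Lemma small_finite T (A : set T) : finite_set A -> small A.
Proof.
by case: k_reg => _ inf _ finA; apply/smallP => /card_le_finite/(_ finA).
Qed.

Lemma small_bounded (S : set On) : S `<=` below k -> small S ->
  exists2 x, x < k & forall y, S y -> y < x.
Proof.
case: k_reg => _ _ reg Sk sS; apply: contrapT => n; apply: (reg _ _ sS).
split=> // x xk; apply: contrapT => n'; apply: n; exists x => // y Sy.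
by rewrite ltNge; apply/negP => xy; apply: n'; exists y.
Qed.

Lemma below_ltS x : x < k -> exists2 y, y < k & x < y.
Proof.
move=> xk; have [||y yk /(_ x erefl) xy] := @small_bounded [set x].
- by move=> _ ->.
- exact/small_finite/finite_set1.
- by exists y.
Qed.

Lemma unbounded_lt (S : set On) x : unbounded S -> x < k -> exists2 y, S y & x < y.
Proof.
move=> uS /below_ltS[x' /uS[y Sy x'y] xx'].
by exists y => //; exact: lt_le_trans x'y.
Qed.

Lemma unbounded_not_small (S : set On) : S `<=` below k -> unbounded S -> ~ small S.
Proof.
move=> Sk uS /small_bounded[//|x xk xS].
by have [y /xS yx xy] := uS _ xk; rewrite leNgt yx in xy.
Qed.

Lemma not_small_unbounded (S : set On) : ~ small S -> unbounded S.
Proof.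
move=> nS x xk; apply: contrapT => n; apply: nS; apply: small_sub (small_below xk) => y Sy.
by rewrite /below /= ltNge; apply/negP => xy; apply: n; exists y.
Qed.

Lemma unbounded_tail (S : set On) x : x < k ->
  unbounded S -> unbounded [set y | S y /\ x < y].
Proof.
move=> xk uS z zk; have mk : Order.max x z < k by rewrite gt_max; exact/andP.
have [y Sy] := unbounded_lt uS mk; rewrite gt_max => /andP[xy zy].
by exists y => //; exact: ltW.
Qed.

(** If [f] embedded [below k] into the union, the ordinals sent into [F j] would be bounded by some
    [b j < k]; an [x < k] above every [b j] then has [f x] in no [F j]. *)
Lemma small_bigcup I T (J : set I) (F : I -> set T) :
  small J -> (forall j, J j -> small (F j)) -> small (\bigcup_(j in J) F j).
Proof.
move=> sJ sF; apply/smallP => le.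
have [k0|/set0P[x0 _]] := eqVneq (below k) set0.
  by case: k_reg => _ + _; rewrite k0; exact.
have nonempty : \bigcup_(j in J) F j !=set0.
  apply/set0P/eqP => e; move: le; rewrite e => /card_le0P k0.
  by case: k_reg => _ + _; rewrite k0; apply; exact: finite_set0.
have [t0 _] := nonempty.
have [f [fF finj]] := card_le_inj t0 le.
pose S j := [set x | x < k /\ F j (f x)].
have sS j : J j -> small (S j).
  move=> /sF; apply: (@small_inj _ _ f) => [x []//|x y [xk _] [yk _]]; exact: finj.
have bS j : exists b, J j -> b < k /\ forall x, S j x -> x < b.
  have [Jj|nJ] := pselect (J j); last by exists x0.
  have [x [] //|b bk bS] := small_bounded _ (sS _ Jj); first by exists b.
have [b bP] := choice bS.
have [_ [j Jj <-]|x xk bx] := @small_bounded (b @` J) _ (small_image b sJ).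
  by have [] := bP _ Jj.
have [j Jj Fj] := fF _ xk.
have [_ /(_ x (conj xk Fj)) xb] := bP _ Jj.
by have := lt_trans xb (bx _ (imageP b Jj)); rewrite ltxx.
Qed.

Lemma smallU T (A B : set T) : small A -> small B -> small (A `|` B).
Proof.
move=> sA sB; have -> : A `|` B = \bigcup_(b in [set: bool]) (if b then A else B).
  apply/seteqP; split=> [x [Ax|Bx]|x [[] _ h]]; [by exists true|by exists false|by left|by right].
by apply: small_bigcup => [|[] _//]; exact/small_finite/finite_finset.
Qed.

Lemma smallX T U (A : set T) (B : set U) : small A -> small B -> small (A `*` B).
Proof.
move=> sA sB; have -> : A `*` B = \bigcup_(a in A) ((fun b => (a, b)) @` B).
  apply/seteqP; split=> [[a b] [/= Aa Bb]|_ [a Aa [b Bb <-]]//]; exists a => //; by exists b.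
by apply: small_bigcup => // a _; exact: small_image.
Qed.

(** [f p] is the least member of [S] above all earlier values. A member [y] never reached would
    exceed them all, and [k] would embed below [y]. *)
Lemma unbounded_order_type (S : set On) : S `<=` below k -> unbounded S ->
  has_order_type S k.
Proof.
move=> Sk uS.
have [f fE] := @wf_rec On (fun x y => x < y) On
  (fun p rec => some_of k [set m | [/\ S m, forall q (h : q < p), rec q h < m
     & forall y, S y -> (forall q (h : q < p), rec q h < y) -> m <= y]]) (lt_wf On_wo).
have fP p : p < k -> [/\ S (f p), forall q, q < p -> f q < f p
     & forall y, S y -> (forall q, q < p -> f q < y) -> f p <= y].
  elim/(well_founded_ind (lt_wf On_wo)): p => p IH pk.
  rewrite [f p]fE; apply: (@some_ofP _ k [set m | [/\ S m, forall q, q < p -> f q < m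
     & forall y, S y -> (forall q, q < p -> f q < y) -> m <= y]]).
  have [_ [q qp <-]|x xk fx] := @small_bounded (f @` below p) _ (small_image f (small_below pk)).
    by have [/Sk] := IH _ qp (lt_trans qp pk).
  have [y0 Sy0 xy0] := uS _ xk.
  have [|m [Sm mp] mmin] := @least _ _ On_wo [set m | S m /\ forall q, q < p -> f q < m].
    exists y0; split=> // q qp; exact: lt_le_trans (fx _ (imageP f qp)) xy0.
  by exists m; split=> // y Sy yp; apply: mmin.
exists f; split; last first.
  by move=> x y /set_mem xk /set_mem yk xy; have [_ /(_ x xy)] := fP _ yk.
apply/seteqP; split=> [_ [x xk <-]|y Sy]; first by have [] := fP _ xk.
apply: contrapT => ny.
have fy p : p < k -> f p < y.
  elim/(well_founded_ind (lt_wf On_wo)): p => p IH pk.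
  have [_ _ /(_ y Sy)] := fP _ pk; rewrite le_eqVlt => h.
  have /orP[/eqP e|//] : (f p == y) || (f p < y).
    by apply: h => q qp; apply: IH => //; exact: lt_trans pk.
  by case: ny; exists p.
have : below k #<= below y.
  apply: (@inj_card_le_fun _ _ _ _ f) => // p q pk qk fpq.
  have [pq|qp|//] := ltgtP p q.
    by have [_ /(_ p pq)] := fP _ qk; rewrite fpq ltxx.
  by have [_ /(_ q qp)] := fP _ pk; rewrite fpq ltxx.
by apply/smallP/small_below; exact: Sk.
Qed.

Lemma order_type_unbounded (S : set On) : has_order_type S k -> unbounded S.
Proof.
move=> [f [<- fmono]]; apply: not_small_unbounded => /smallP; apply.
apply: (@inj_card_le_fun _ _ _ _ f) => [x xk|x y xk yk e]; first by exists x.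
have [pq|qp|//] := ltgtP x y.
  by have := fmono x y (mem_set xk) (mem_set yk) pq; rewrite e ltxx.
by have := fmono y x (mem_set yk) (mem_set xk) qp; rewrite e ltxx.
Qed.
End Small.

(** * Weakly compact cardinals *)

Section WeaklyCompact.
Context {d : Order.disp_t} {On : orderType d}.
Context (On_wo : well_order (<=%O : rel On)).
Context (k : On).
Context (k_reg : regular_cardinal k).

Lemma eventually_all I (J : set I) (P : I -> On -> Prop) : small k J ->
  (forall j, J j -> exists2 b, b < k & forall u, b <= u -> P j u) ->
  exists2 b, b < k & forall u, b <= u -> forall j, J j -> P j u.
Proof.
move=> sJ H.
have /choice[b bP] : forall j, exists b, J j -> b < k /\ forall u, b <= u -> P j u.
  move=> j; have [/H[b bk bP]|nJ] := pselect (J j); first by exists b.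
  by exists k.
have [_ [j Jj <-]|x xk bx] := small_bounded k_reg _ (small_image b sJ).
  by have [] := bP _ Jj.
exists x => // u xu j Jj; have [_] := bP _ Jj; apply.
exact: le_trans (ltW (bx _ (imageP b Jj))) xu.
Qed.

(* Homogeneity for the lexicographic order makes t monotone on S, so by induction
   on z the values t u z are eventually constant. *)
Lemma weakly_compact_limit (t : On -> On -> bool) : weakly_compact k ->
  exists S h, [/\ S `<=` below k, unbounded k S & forall x, x < k ->
    exists2 b, b < k & forall u, b <= u -> forall z, z < x -> S u -> t u z = h z].
Proof.
move=> wc.
pose agree x y z := forall w, w < z -> t x w = t y w.
(* Colour [true] says that [t x] precedes [t y] lexicographically, [z] being the first place of
   difference. *)
have [S [Sk /(order_type_unbounded k_reg) uS [c cP]]] :=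
  wc (fun x y => `[< exists z, [/\ agree x y z, t x z = false & t y z] >]).
(* Where two terms agree below [z], passing to the later one can change the value at [z] only
   towards [c]. *)
have mono x y z : S x -> S y -> x < y -> agree x y z -> t x z = c -> t y z = c.
  move=> Sx Sy xy xyz txz; have := cP _ _ Sx Sy xy; case: c txz {cP} => txz.
    move=> /asboolP[w [aw tx ty]]; have [wz|zw|e] := ltgtP w z.
    - by have := xyz _ wz; rewrite tx ty.
    - by rewrite -aw.
    - by rewrite -e tx in txz.
  by move=> /asboolPn n; apply/negbTE/negP => tyz; apply: n; exists z.
have step z : z < k -> exists v, exists2 b, b < k & forall u, b <= u -> S u -> t u z = v.
  elim/(well_founded_ind (lt_wf On_wo)): z => z IH zk.
  have [v vP] : exists v : On -> bool, forall w, w < z ->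
      exists2 b, b < k & forall u, b <= u -> S u -> t u w = v w.
    have /choice[v vP] : forall w, exists v, w < z ->
      exists2 b, b < k & forall u, b <= u -> S u -> t u w = v.
      move=> w; have [wz|nwz] := pselect (w < z); last by exists true.
      by have [v vP] := IH _ wz (lt_trans wz zk); exists v.
    by exists v.
  have [b bk bP] := eventually_all (small_below k_reg zk) vP.
  have ag x y : S x -> S y -> b <= x -> b <= y -> agree x y z.
    by move=> Sx Sy bx by' w wz; rewrite (bP _ bx)// (bP _ by').
  have [[u [Su bu tu]]|n] := pselect (exists u, [/\ S u, b <= u & t u z = c]).
    exists c, u => [|u' uu' Su']; first exact: Sk.
    move: uu'; rewrite le_eqVlt => /orP[/eqP <-//|uu'].
    by apply: (mono u) => //; apply: ag => //; exact: le_trans (ltW uu').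
  exists (~~ c), b => // u bu Su.
  have : t u z <> c by move=> tuc; apply: n; exists u.
  by case: (t u z); case: (c) => // /(_ erefl).
have [h hP] : exists h : On -> bool, forall z, z < k ->
    exists2 b, b < k & forall u, b <= u -> S u -> t u z = h z.
  have /choice[h hP] : forall z, exists v, z < k ->
      exists2 b, b < k & forall u, b <= u -> S u -> t u z = v.
    move=> z; have [zk|nzk] := pselect (z < k); last by exists true.
    by have [v vP] := step _ zk; exists v.
  by exists h.
exists S, h; split=> // x xk.
apply: (eventually_all (P := fun z u => S u -> t u z = h z) (small_below k_reg xk)) => z zx.
exact: hP (lt_trans zx xk).
Qed.

(** The set $2^x$: padding with [false] makes each sequence of length [x] a unique total
    function. *)
Definition supported x : set (On -> bool) := [set s | forall z, x <= z -> s z = false].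

(** Weakly compact cardinals are strong limits: among [k] sequences of length [x], the limit lemma
    finds two with equal values below [x]. *)
Lemma small_supported x : weakly_compact k -> x < k -> small k (supported x).
Proof.
move=> wc xk; apply/smallP => /(card_le_inj (fun=> false))[t [tx tinj]].
have [S [h [Sk uS /(_ _ xk)[b bk bP]]]] := weakly_compact_limit t wc.
have [u Su bu] := uS _ bk.
have [u' Su' uu'] := unbounded_lt k_reg uS (Sk _ Su).
suff e : t u = t u' by have := tinj _ _ (Sk _ Su) (Sk _ Su') e => e'; rewrite e' ltxx in uu'.
apply/funext => z; have [zx|xz] := ltP z x.
  by rewrite (bP _ bu)// (bP _ (le_trans bu (ltW uu'))).
by rewrite (tx _ (Sk _ Su))// (tx _ (Sk _ Su')).
Qed.

Lemma small_inj_below T (a : set T) : small k a ->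
  exists2 x, x < k & exists g : T -> On,
    (forall y, a y -> g y < x) /\ forall y z, a y -> a z -> g y = g z -> y = z.
Proof.
move=> sa; have [/(card_le_inj k)[g [gk ginj]] _] := sa.
have [_ [y ay <-]|x xk gx] := small_bounded k_reg _ (small_image g sa); first exact: gk.
by exists x => //; exists g; split=> // y ay; apply: gx; exists y.
Qed.

Lemma small_powerset T (a : set T) : weakly_compact k -> small k a ->
  small k [set c : set T | c `<=` a].
Proof.
move=> wc /small_inj_below[x xk [g [gx ginj]]].
apply: (@small_inj _ _ _ _ _ (fun c z => `[< exists2 y, c y & g y = z >]) _ (supported x)).
- move=> c ca z xz; apply/asboolPn => -[y /ca /gx yx e].
  by move: yx; rewrite e ltNge xz.
- move=> c c' ca c'a e; apply/seteqP; split=> y cy.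
    have : `[< exists2 y', c' y' & g y' = g y >].
      by rewrite -(congr1 (fun f => f (g y)) e); apply/asboolP; exists y.
    by move=> /asboolP[y' c'y' /ginj <-//]; [exact: c'a|exact: ca].
  have : `[< exists2 y', c y' & g y' = g y >].
    by rewrite (congr1 (fun f => f (g y)) e); apply/asboolP; exists y.
  by move=> /asboolP[y' c'y' /ginj <-//]; [exact: ca|exact: c'a].
- exact: small_supported.
Qed.
End WeaklyCompact.

(** * Positive sets and traces *)

Section Traces.
Context {d : Order.disp_t} {On : orderType d}.
Context (On_wo : well_order (<=%O : rel On)).
Context (k l : On).
Context (k_reg : regular_cardinal k).
Context (kl : k < l).
Implicit Types (a b : set On) (A B : set (set On)).

Lemma trace_lt a : Pkl k l a -> trace k a < k.
Proof. by case/(below_trace On_wo k_reg). Qed.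

Lemma trace_ge a x : Pkl k l a -> a x -> x < k -> x <= trace k a.
Proof.
case/(below_trace On_wo k_reg) => e _ ax xk; rewrite leNgt; apply/negP => lt.
have : below (trace k a) (trace k a) by rewrite e; exists x.
by rewrite /below /= ltxx.
Qed.

(** This lets a trace be prescribed, by adjoining an ordinal below [k] that exceeds the rest of [a]
    below [k]. *)
Lemma trace_max a x : Pkl k l a -> a x -> x < k ->
  (forall y, a y -> y < k -> y <= x) -> trace k a = x.
Proof.
move=> Pa ax xk xmax; apply/eqP; rewrite eq_le (trace_ge Pa ax xk) andbT.
rewrite leNgt; apply/negP => lt.
have [e _] := below_trace On_wo k_reg Pa.
have : below (trace k a) x by [].
by rewrite e => -[y [ay yk]]; rewrite /below /= ltNge xmax.
Qed.

Lemma PklU a b : Pkl k l a -> Pkl k l b -> Pkl k l (a `|` b).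
Proof. by move=> [al sa] [bl sb]; split; [rewrite subUset|exact: smallU]. Qed.

Lemma Pkl1 x : x < l -> Pkl k l [set x].
Proof. by move=> xl; split; [move=> _ ->|exact/small_finite/finite_set1]. Qed.

Lemma positiveP A : positive k l (ideal_I k l) A <->
  A `<=` Pkl k l /\ forall a, Pkl k l a -> exists2 b, A b & a `<=` b.
Proof.
split=> -[Akl cof]; split=> //.
  move=> a Pa; apply: contrapT => n; apply: cof; split=> //; exists a => //.
  apply/seteqP; split=> [b [Ab [_ ab]]|//]; apply: n; by exists b.
move=> [_ [a Pa e]]; have [b Ab ab] := cof _ Pa.
suff : (set0 : set (set On)) b by [].
by rewrite -e; split=> //; split=> //; exact: Akl.
Qed.

Lemma positive_traces B : positive k l (ideal_I k l) B ->
  trace k @` B `<=` below k /\ unbounded k (trace k @` B).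
Proof.
move=> /positiveP[Bkl cof]; split=> [_ [b /Bkl/trace_lt ? <-]//|x xk].
have [b Bb xb] := cof _ (Pkl1 (lt_trans xk kl)).
by exists (trace k b); [exists b|apply: trace_ge => //; [exact: Bkl|exact: xb]].
Qed.

End Traces.

(** * Dense open sets as sets of conditions *)

Section Conditions.
Context {d : Order.disp_t} {On : orderType d}.
Context (k : On).
Context (k_reg : regular_cardinal k).
Implicit Types (D : On -> (On -> bool) -> Prop) (U : set (two_pow k)).

(** Points of $2^k$ live on a subtype, conditions are total functions; [ext] and [res] pass between
    the two. *)
Definition ext (f : two_pow k) (z : On) : bool :=
  if pselect (below k z) is left h then f (exist _ z (mem_set h)) else false.

Definition res (x : On -> bool) : two_pow k := fun z => x (val z).

Definition box b (x : On -> bool) : set (two_pow k) :=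
  [set f | forall z : below k, val z < b -> f z = x (val z)].

(* A pair (b, x) with b < k stands for the condition x|b, and a predicate D on
   such pairs for the set of conditions whose box lies in an open set. *)
Definition cond_open D : Prop := forall b x b' x',
  D b x -> b <= b' -> b' < k -> (forall z, z < b -> x' z = x z) -> D b' x'.

Definition cond_dense D : Prop := forall b x, b < k ->
  exists b' x', [/\ b <= b', b' < k, forall z, z < b -> x' z = x z & D b' x'].

Definition cond_set D : set (two_pow k) := [set f | exists2 b, b < k & D b (ext f)].

Lemma ext_val f (z : below k) : ext f (val z) = f z.
Proof.
rewrite /ext; case: pselect => [h|[]]; last exact: set_mem (valP z).
by congr f; exact: val_inj.
Qed.

Lemma ext_res x z : z < k -> ext (res x) z = x z.
Proof. by rewrite /ext; case: pselect. Qed.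

Lemma box_basic b x : b < k -> basic_open (box b x).
Proof.
move=> bk; right; exists (below b).
  by split; [apply/below_sub/ltW|exact: small_below].
exists (fun y => x (val y)); apply/seteqP; split=> f fP.
  by move=> z y zy; rewrite -zy; apply: fP; rewrite zy; exact: set_mem (valP y).
by move=> z zb; apply: (fP z (exist _ (val z) (mem_set (zb : below b (val z))))).
Qed.

(** By regularity the small domain of a basic condition is bounded below [k], so boxes on initial
    segments suffice. *)
Lemma open_box U f : open_kk U -> U f -> exists2 b, b < k & box b (ext f) `<=` U.
Proof.
move=> [X Xb ->] [V XV Vf]; case: (Xb _ XV) => [V0|[a [ak sa] [s Vs]]].
  by rewrite V0 in Vf.
have [b bk ab] := small_bounded k_reg ak sa.
exists b => // g gb; exists V => //; rewrite Vs in Vf *.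
move=> x y xy; rewrite gb ?ext_val; first exact: Vf.
by rewrite xy; apply: ab; exact: set_mem (valP y).
Qed.

Lemma box_ext b f : box b (ext f) f.
Proof. by move=> z _; rewrite ext_val. Qed.

Lemma cond_set_open D : cond_open D -> open_kk (cond_set D).
Proof.
move=> oD; exists [set V | exists b x, [/\ b < k, D b x & V = box b x]].
  by move=> _ [b [x [bk _ ->]]]; exact: box_basic.
apply/seteqP; split=> [f [b bk Df]|f [_ [b [x [bk Dx ->]]] fb]].
  by exists (box b (ext f)); [exists b, (ext f)|exact: box_ext].
exists b => //; apply: oD Dx _ _ _ => // z zb.
by have := fb (exist _ z (mem_set (lt_trans zb bk : below k z))) zb; rewrite -ext_val.
Qed.

Lemma cond_set_dense D : cond_open D -> cond_dense D -> dense_kk (cond_set D).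
Proof.
move=> oD dD U oU [f Uf]; have [b bk bU] := open_box oU Uf.
have [b' [x [bb' b'k xf Dx]]] := dD b (ext f) bk.
exists (res x); split; last by apply: bU => z zb; exact: xf.
exists b' => //; apply: oD Dx _ _ _ => // z zb'.
by rewrite ext_res//; exact: lt_trans b'k.
Qed.

Lemma open_cond U : cond_open (fun b x => box b x `<=` U).
Proof.
move=> b x b' x' bU bb' _ xx' f fb'; apply: bU => z zb.
by rewrite fb' ?xx'//; exact: lt_le_trans bb'.
Qed.

Lemma dense_cond U : open_kk U -> dense_kk U -> cond_dense (fun b x => box b x `<=` U).
Proof.
move=> oU dU b x bk.
have [] := dU (box b x).
- by exists [set box b x]; [move=> _ ->; exact: box_basic|rewrite bigcup_set1].
- by exists (res x).
move=> f [Uf fb]; have [c ck cU] := open_box oU Uf.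
exists (Order.max b c), (ext f); split.
- by rewrite le_max lexx.
- by rewrite gt_max bk.
- move=> z zb; have := fb (exist _ z (mem_set (lt_trans zb bk : below k z))) zb.
  by rewrite -ext_val.
- by apply: open_cond cU _ _ _ => //; [rewrite le_max lexx orbT|rewrite gt_max bk].
Qed.
End Conditions.

(** * Covering numbers give homogeneous sets *)

Section Forward.
Context {d : Order.disp_t} {On : orderType d}.
Context (On_wo : well_order (<=%O : rel On)).
Context (k l : On).
Context (k_reg : regular_cardinal k).
Context (kl : k < l).

(** Every member of $P_k(l)$ is the range of a sequence of length below [k]; for the empty set the
    length is the least ordinal. *)
Lemma Pkl_le_lt_pow : Pkl k l #<= [set: lt_pow l k].
Proof.
pose ran (s : lt_pow l k) : set On := [set val (projT2 s i) | i in setT].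
apply: card_le_trans (card_image_le ran _); apply: subset_card_le => a [al sa].
have [a0|/set0P ane] := eqVneq a set0.
  have [u _ umin] := least On_wo (ex_intro setT k I).
  have uk : below k u.
    case: k_reg => _ inf _; have [v vk] := infinite_setN0 inf.
    exact: le_lt_trans (umin _ I) vk.
  exists (existT _ (exist _ u (mem_set uk)) (fun=> exist _ k (mem_set (kl : below l k)))) => //.
  rewrite a0; apply/seteqP; split=> // _ [[i iu] _ <-].
  by move: (set_mem iu); rewrite /below /= ltNge umin.
have [u uk [g [gu ginj]]] := small_inj_below k_reg sa.
have [f fa] := card_le_surj k ane (inj_card_le_fun (gu : forall y, a y -> below u (g y)) ginj).
have fl z : below u z -> below l (f z) by move=> uz; apply: al; rewrite -fa; exists z.
exists (existT _ (exist _ u (mem_set (uk : below k u)))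
  (fun i => exist _ (f (val i)) (mem_set (fl _ (set_mem (valP i)))))) => //.
apply/seteqP; split=> [_ [i _ <-]|y]; rewrite -fa.
  by exists (val i) => //; exact: set_mem (valP i).
by move=> [z zu <-]; exists (exist _ z (mem_set zu)).
Qed.

Lemma arrow_k_of_cov : weakly_compact k -> lt_pow_lt_cov l k ->
  arrow_k k l (ideal_I k l).
Proof.
move=> wc [Y [[_ Ymin] [_ nYle]]] F A /(positiveP) [Akl Acof].
pose Apos t x := forall a, Pkl k l a -> exists b, [/\ A b, a `<=` b, x <= trace k b
  & forall z, z < x -> F (z, b) = t z].
have /choice[t tP] : forall x, exists t, x < k -> Apos t x.
  move=> x; have [xk|nxk] := pselect (x < k); last by exists (fun=> true).
  apply: contrapT => n.
  have /choice[c cP] : forall s : On -> bool, exists c, Pkl k l c /\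
      forall b, A b -> c `<=` b -> x <= trace k b -> ~ forall z, z < x -> F (z, b) = s z.
    move=> s; apply: contrapT => n'; apply: n; exists s => _ a Pa.
    apply: contrapT => n''; apply: n'; exists a; split=> // b Ab ab xb bs.
    by apply: n''; exists b.
  (* Some [b] in [A] contains [x], so its trace is at least [x], and contains every [c s]; it
     refutes the choice of [c] at its own sequence [F(., b)] cut off at [x]. *)
  have [] := Acof ((\bigcup_(s in supported x) c s) `|` [set x]).
    apply: PklU => //; last exact/Pkl1/(lt_trans xk).
    split; first by move=> z [s _]; have [[sl _] _] := cP s; exact: sl.
    apply: small_bigcup => //; first exact: small_supported.
    by move=> s _; have [[]] := cP s.
  move=> b Ab cb; pose s z := (z < x) && F (z, b).
  have [_ /(_ b Ab)] := cP s; apply; last by move=> z zx; rewrite /s zx.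
    move=> z cz; apply: cb; left; exists s => // y xy.
    by rewrite /s ltNge xy.
  by apply: trace_ge => //; [exact: Akl|apply: cb; right].
have [S [h [Sk uS hP]]] := weakly_compact_limit On_wo k_reg t wc.
(* Below [x] the limit [h] agrees with some [t u], [u] at least [x], and inherits its sets [c]. *)
have Ah x : x < k -> Apos h x.
  move=> xk a Pa; have [b bk bP] := hP _ xk.
  have mk : Order.max x b < k by rewrite gt_max xk.
  have [u Su] := uS _ mk; rewrite ge_max => /andP[xu bu].
  have [c [Ac ac uc Fc]] := tP u (Sk _ Su) a Pa.
  exists c; split=> //; first exact: le_trans uc.
  by move=> z zx; rewrite Fc ?(bP u)//; exact: lt_le_trans xu.
(* The point [x] is read as a set of ordinals: it must contain the trace of [b], and [F(., b)] must
   follow [h] at its earlier members. *)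
pose good x b := x (trace k b) /\ forall z, z < trace k b -> x z -> F (z, b) = h z.
pose D a c x := exists b, [/\ A b, a `<=` b, trace k b < c & good x b].
have oD a : cond_open k (D a).
  move=> c x c' x' [b [Ab ab bc [xb xF]]] cc' _ xx'; exists b; split=> //.
    exact: lt_le_trans cc'.
  by split=> [|z zb]; rewrite xx'//; [exact: xF|exact: lt_trans bc].
have dD a : Pkl k l a -> cond_dense k (D a).
  move=> Pa c x ck; have [b [Ab ab cb Fb]] := Ah _ ck _ Pa.
  have [c' c'k bc'] := below_ltS k_reg (trace_lt On_wo k_reg (Akl _ Ab)).
  (* From [c] on, only the trace of [b] is put into the set; below [c], [F(., b)] is already equal
     to [h]. *)
  exists c', (fun z => if z < c then x z else z == trace k b); split=> //.
  - exact: ltW (le_lt_trans cb bc').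
  - by move=> z ->.
  exists b; split=> //; split; first by rewrite ltNge cb eqxx.
  move=> z zb; case: ltP => [zc _|_ /eqP e]; first exact: Fb.
  by rewrite e ltxx in zb.
(* Otherwise the complements of the sets [cond_set (D a)] would be a meager cover with at most
   $l^{<k}$ members. *)
have [f fP] : exists f : two_pow k, forall a, Pkl k l a -> cond_set (D a) f.
  apply: contrapT => n.
  apply: nYle; apply: card_le_trans _ Pkl_le_lt_pow.
  apply: card_le_trans (card_image_le (fun a => ~` cond_set (D a)) _).
  apply: Ymin; split.
    move=> _ [a Pa <-]; exists [set cond_set (D a)]; split.
    - move=> _ ->; split; first exact: cond_set_open.
      by apply: cond_set_dense => //; exact: dD.
    - by exists (cond_set (D a)).
    - by have [] := small_finite k_reg (finite_set1 (cond_set (D a) : set (two_pow k))).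
    - by rewrite bigcap_set1; exact: setICl.
  apply/seteqP; split=> // f _; apply: contrapT => nf; apply: n; exists f => a Pa.
  by apply: contrapT => nD; apply: nf; exists (~` cond_set (D a)); [exists a|].
have gP a : Pkl k l a -> exists b, [/\ A b, a `<=` b & good (ext f) b].
  by move=> /fP[c _ [b [Ab ab _ gb]]]; exists b.
pose B i := [set b | [/\ A b, good (ext f) b & h (trace k b) = i]].
have hom i p : pairs_k k (B i) p -> F p = i.
  move=> [a [b [[_ [xa _] <-] [_ [_ bF] _] ab ->]]]; exact: bF.
have BA i : B i `<=` A by move=> b [].
have [c1|n] := pselect (forall a, Pkl k l a -> exists2 b, B true b & a `<=` b).
  exists (B true); split=> //; last by exists true; exact: hom.
  by apply/positiveP; split=> // b /BA/Akl.
(* No member of [B true] contains [a0], so every good [b] in [A] above [a0] falls into [B false]. *)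
have [a0 Pa0 na0] : exists2 a, Pkl k l a & forall b, B true b -> ~ (a `<=` b).
  apply: contrapT => n'; apply: n => a Pa; apply: contrapT => n''; apply: n'.
  by exists a => // b Bb ab; apply: n''; exists b.
exists (B false); split=> //; last by exists false; exact: hom.
apply/positiveP; split=> [b /BA/Akl//|a Pa].
have [b [Ab ab gb]] := gP _ (PklU k_reg Pa Pa0).
exists b; last by move=> z az; apply: ab; left.
split=> //; apply/negbTE/negP => hb; apply: (na0 b) => // z az.
by apply: ab; right.
Qed.

(** Let the colour depend on [b] only through its trace. A positive set has unboundedly many traces,
    so either colour gives what is wanted. *)
Lemma arrow_kk_of_arrow_k : arrow_k k l (ideal_I k l) -> arrow_kk k l (ideal_I k l) k.
Proof.
move=> arr F A posA.
pose G (p : On * set On) := F (p.1, trace k p.2).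
have [B [posB BA [c cP]]] := arr G A posA.
exists B; split=> //.
have FB p : pairs_kk k B p -> F p = c.
  by move=> [a [b [Ba Bb ab ->]]]; apply: (cP (trace k a, b)); exists a, b.
have [Tk uT] := positive_traces On_wo k_reg kl posB.
by case: c FB {cP} => FB; [right|left]; split=> //; exact: unbounded_order_type.
Qed.
End Forward.

(** * Coding sequences by subsets of lambda above kappa *)

Section Tags.
Context {d : Order.disp_t} {On : orderType d}.
Context (On_wo : well_order (<=%O : rel On)).
Context (k l : On).
Context (k_reg : regular_cardinal k).
Context (l_card : is_cardinal l).
Context (kl : k < l).

Lemma below_square_le (x : On) : infinite_set (below x) -> below x `*` below x #<= below x.
Proof.
move=> /(card_ordinal On_wo)[u [ux cu iu leu]].
apply: card_le_trans (card_le_setX leu leu) _.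
apply: card_le_trans (card_square_le On_wo cu iu) _.
by apply/subset_card_le/below_sub.
Qed.

(** Small subsets of this interval will index the meager sets. *)
Definition upper : set On := [set z | k <= z /\ z < l].

(** Were [upper] to embed below some [p < l], two tagged copies of [below q], with [q] the maximum
    of [p] and [k], would hold all of [below l], although [q < l]. *)
Lemma below_le_upper : below l #<= upper.
Proof.
have [_ ik _] := k_reg.
apply: (segments_card_le (lt_wf On_wo)) => [p q|p pl le].
  by case: (ltgtP p q); [constructor 1|constructor 3|constructor 2].
have {}le : upper #<= below p.
  by apply: card_le_trans le _; apply: subset_card_le => q [].
pose q := Order.max p k; have ql : q < l by rewrite gt_max; apply/andP.
have kq : k <= q by rewrite le_max lexx orbT.
have iq : infinite_set (below q).
  by move=> /(card_le_finite (subset_card_le (below_sub kq))).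
have [f [fp finj]] := card_le_inj k le.
have [o0 o0k] := infinite_setN0 ik; have [o1 o1k o01] := below_ltS k_reg o0k.
apply: (card_ltW l_card ql); apply: card_le_trans (below_square_le iq).
apply: (@inj_card_le_fun _ _ _ _ (fun z => if z < k then (z, o0) else (f z, o1))).
  move=> z zl; case: (ltP z k) => zk; split=> /=; try exact: lt_le_trans kq.
  by have := fp z (conj zk zl); rewrite /below /= /q lt_max => ->.
move=> y z yl zl; case: (ltP y k) => yk; case: (ltP z k) => zk.
- by case.
- by case=> _ e; rewrite e ltxx in o01.
- by case=> _ e; rewrite e ltxx in o01.
- by case=> /finj; apply.
Qed.

Lemma infinite_below_l : infinite_set (below l).
Proof.
have [_ ik _] := k_reg.
by move=> /(card_le_finite (subset_card_le (below_sub (ltW kl)))).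
Qed.

Lemma pairing_upper : exists J : On * On -> On,
  (forall p, p.1 < l -> p.2 < l -> upper (J p)) /\
  forall p q, p.1 < l -> p.2 < l -> q.1 < l -> q.2 < l -> J p = J q -> p = q.
Proof.
have := card_le_trans (below_square_le infinite_below_l) below_le_upper.
move=> /(card_le_inj k)[J [Jup Jinj]]; exists J; split.
  by move=> p p1 p2; apply: Jup.
by move=> p q p1 p2 q1 q2; apply: Jinj.
Qed.

(** A sequence is coded by its graph, the small set of [J]-codes of its pairs of index and value,
    which also determines the length. *)
Lemma lt_pow_le_upper :
  [set: lt_pow l k] #<= [set c : set On | c `<=` upper /\ small k c].
Proof.
have [J [Jup Jinj]] := pairing_upper.
pose tag (s : lt_pow l k) : set On := [set J (val i, val (projT2 s i)) | i in setT].
have vl (s : lt_pow l k) i : val i < l /\ val (projT2 s i) < l.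
  split; last exact: (set_mem (valP (projT2 s i))).

  have ui : val i < val (projT1 s) by exact: set_mem (valP i).
  exact: lt_trans (lt_trans ui (set_mem (valP (projT1 s)))) kl.
have sub s s' : tag s = tag s' -> forall i, exists2 j,
    val i = val j & val (projT2 s i) = val (projT2 s' j).
  move=> e i; have : tag s (J (val i, val (projT2 s i))) by exists i.
  have [i1 i2] := vl s i.
  rewrite e => -[j _ /Jinj /=]; have [j1 j2] := vl s' j.
  by move=> /(_ j1 j2 i1 i2)[<- <-]; exists j.
apply: (@inj_card_le_fun _ _ _ _ tag).
  move=> s _; split=> [_ [i _ <-]|]; first by have [i1 i2] := vl s i; exact: (Jup (_, _) i1 i2).
  apply: small_image; apply: small_le _ (small_below k_reg (set_mem (valP (projT1 s)))).

  by have := card_setT (below (val (projT1 s))); rewrite card_eq_le => /andP[].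
move=> s s' _ _ e.
have := sub _ _ e; have := sub _ _ (esym e).
case: s s' {e} => -[u uk] f [[u' uk'] f'] /= h' h.
have uu' : u = u'.
  apply/eqP; rewrite eq_le !leNgt; apply/andP; split; apply/negP => lt.
    have [[j ju] /= e _] := h (exist _ u' (mem_set (lt : below u u'))).
    by have := set_mem ju; rewrite /below /= -e ltxx.
  have [[j ju] /= e _] := h' (exist _ u (mem_set (lt : below u' u))).
  by have := set_mem ju; rewrite /below /= -e ltxx.
subst u'; rewrite (Prop_irrelevance uk' uk) in f' h h' *.
congr existT; apply/funext => i; apply/val_inj; have [j e e'] := h i; apply: (etrans e').
by congr (val (f' _)); apply/val_inj.
Qed.
End Tags.

(** * Intersections of fewer than kappa dense open sets *)

Section Baire.
Context {d : Order.disp_t} {On : orderType d}.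
Context (On_wo : well_order (<=%O : rel On)).
Context (k : On).
Context (k_reg : regular_cardinal k).

(** Index [J] below some [m < k] by [g] and build a chain of conditions entering [D j] at stage
    [g j]; regularity keeps the lengths below [k], and openness preserves [D j] up to stage [m]. *)
Lemma cond_dense_forall I (J : set I) (D : I -> On -> (On -> bool) -> Prop) :
  small k J -> (forall j, J j -> cond_open k (D j)) ->
  (forall j, J j -> cond_dense k (D j)) ->
  cond_dense k (fun b x => forall j, J j -> D j b x).
Proof.
move=> sJ oD dD b0 x0 b0k.
have [m mk [g [gm ginj]]] := small_inj_below k_reg sJ.
have /choice[step stepP] : forall ip : On * (On * (On -> bool)), exists q : On * (On -> bool),
    ip.2.1 < k -> [/\ ip.2.1 <= q.1, q.1 < k, forall z, z < ip.2.1 -> q.2 z = ip.2.2 z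
      & forall j, J j -> g j = ip.1 -> D j q.1 q.2].
  move=> [i [b x]] /=.
  have [[j [Jj gj]]|n] := pselect (exists j, J j /\ g j = i); last first.
    by exists (b, x) => bk; split=> // j Jj gj; case: n; exists j.
  have [bk|nbk] := pselect (b < k); last by exists (b, x).
  have [b' [x' [bb' b'k xx' Dx']]] := dD _ Jj b x bk.
  exists (b', x') => _; split=> // j' Jj' gj'.
  by rewrite (ginj _ _ Jj' Jj)// gj' gj.
have [f fE] := @wf_rec On (fun x y => x < y) (On * (On -> bool))
  (fun p rec => step (p, (some_of k
       [set s | [/\ b0 <= s, s < k & forall q (h : q < p), (rec q h).1 <= s]],
     fun z => if z < b0 then x0 z else
       some_of false [set v | exists q (h : q < p), z < (rec q h).1 /\ v = (rec q h).2 z])))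
  (lt_wf On_wo).
(* [s p] is a length covering all stages before [p], and [y p] glues these stages to [x0] on
   [b0]. *)
pose s p := some_of k [set s | [/\ b0 <= s, s < k & forall q, q < p -> (f q).1 <= s]].
pose y p z := if z < b0 then x0 z else
  some_of false [set v | exists q (h : q < p), z < (f q).1 /\ v = (f q).2 z].
have {}fE p : f p = step (p, (s p, y p)) by exact: fE.
pose P p := [/\ b0 <= s p, s p < k & forall q, q < p -> (f q).1 <= s p /\
  forall z, z < (f q).1 -> y p z = (f q).2 z].
have fP p : P p -> [/\ s p <= (f p).1, (f p).1 < k, forall z, z < s p -> (f p).2 z = y p z
      & forall j, J j -> g j = p -> D j (f p).1 (f p).2].
  by case=> _ spk _; rewrite fE; exact: stepP (p, (s p, y p)) spk.
have PP p : p < k -> P p.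
  elim/(well_founded_ind (lt_wf On_wo)): p => p IH pk.
  have IH' q : q < p -> P q by move=> qp; apply: IH => //; exact: lt_trans pk.
  have [b0s sk sf] : [set s | [/\ b0 <= s, s < k & forall q, q < p -> (f q).1 <= s]] (s p).
    apply: some_ofP.
    have [_ [q qp <-]|c ck fc] := small_bounded k_reg _
        (small_image (fun q => (f q).1) (small_below k_reg pk)).
      by have [] := fP _ (IH' _ qp).
    exists (Order.max b0 c); split; first by rewrite le_max lexx.
      by rewrite gt_max b0k.
    by move=> q qp; rewrite le_max (ltW (fc _ _)) ?orbT//; exists q.
  have coh q q' z : q < q' -> q' < p -> z < (f q).1 -> (f q').2 z = (f q).2 z.
    move=> qq' q'p zq; have [_ _ Pq'] := IH' _ q'p.
    have [fqs yq] := Pq' _ qq'; have [_ _ fy _] := fP _ (IH' _ q'p).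
    by rewrite fy ?yq// (lt_le_trans zq fqs).
  split=> // q qp; split; first exact: sf.
  move=> z zq; rewrite /y; case: ltP => zb0.
    have [_ _ fy _] := fP _ (IH' _ qp); have [b0q _ _] := IH' _ qp.
    by rewrite fy ?(lt_le_trans zb0)// /y zb0.
  have /(some_ofP false)[q' [q'p [zq' ->]]] :
      [set v | exists q (h : q < p), z < (f q).1 /\ v = (f q).2 z] !=set0.
    by exists ((f q).2 z), q, qp.
  have [qq'|q'q|->//] := ltgtP q q'; first exact: coh.
  by apply/esym; exact: coh.
have [b0s sk Pm] := PP _ mk.
exists (s m), (y m); split=> //; first by move=> z zb0; rewrite /y zb0.
move=> j Jj; have gjm := gm _ Jj; have [fs fy] := Pm _ gjm.
have [_ _ _ /(_ _ Jj erefl) Dj] := fP _ (PP _ (lt_trans gjm mk)).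
exact: oD Dj _ _ _.
Qed.

End Baire.

(** * Homogeneous sets give points outside few meager sets *)

Section Core.
Context {d : Order.disp_t} {On : orderType d}.
Context (On_wo : well_order (<=%O : rel On)).
Context (k l : On).
Context (k_reg : regular_cardinal k).
Context (l_card : is_cardinal l).
Context (kl : k < l).

(** This part of [b], its tag, has no influence on the trace. *)
Definition hi (b : set On) : set On := [set z | b z /\ k <= z].

Lemma hi_upper b : Pkl k l b -> hi b `<=` upper k l /\ small k (hi b).
Proof.
move=> [bl sb]; split=> [z [/bl bz kz]//|].
by apply: small_sub sb => z [].
Qed.

(** Adjoin to [a] a member [x] of [G (hi a)] beyond its elements below [k]: the trace becomes [x]
    and the tag stays the same. *)
Lemma positive_of_traces (G : set On -> set On) :
  (forall a, a `<=` upper k l -> small k a -> G a `<=` below k /\ unbounded k (G a)) ->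
  positive k l (ideal_I k l) [set b | Pkl k l b /\ G (hi b) (trace k b)].
Proof.
move=> HG; apply/positiveP; split=> [b []//|a Pa].
have [Gk uG] := HG _ (hi_upper Pa).1 (hi_upper Pa).2.
have [_ sa] := Pa.
have [c ck ac] : exists2 c, c < k & forall y, a y -> y < k -> y < c.
  have [y []//||c ck ac] := @small_bounded _ _ _ k_reg [set y | a y /\ y < k].
    by apply: small_sub sa => y [].
  by exists c => // y ay yk; apply: ac.
have [x Gx cx] := uG _ ck; have xk := Gk _ Gx.
exists (a `|` [set x]); last by move=> z az; left.
have Pb : Pkl k l (a `|` [set x]) by apply: PklU => //; exact/(Pkl1 k_reg)/(lt_trans xk).
split=> //; rewrite (trace_max On_wo k_reg Pb (x := x))//; [|by right|].
  have -> // : hi (a `|` [set x]) = hi a.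
  apply/seteqP; split=> z [az kz]; split=> //; last by left.
  by case: az kz => // ->; rewrite leNgt xk.
by move=> y [/ac ay /ay yc|->//]; exact: ltW (lt_le_trans yc cx).
Qed.

Definition splice (al : On) (t s : On -> bool) : On -> bool :=
  fun z => if z < al then t z else s z.

Context (J : On * On -> On).
Context (J_upper : forall p, p.1 < l -> p.2 < l -> upper k l (J p)).
Context (J_inj : forall p q, p.1 < l -> p.2 < l -> q.1 < l -> q.2 < l ->
  J p = J q -> p = q).

(** A copy of [k] inside [upper]: having [e z] in the tag will demand a block that starts above
    [z]. *)
Let e (z : On) : On := J (z, z).

Let e_upper z : z < k -> upper k l (e z).
Proof. by move=> zk; apply: J_upper => //=; exact: lt_trans kl. Qed.

Let e_inj y z : y < k -> z < k -> e y = e z -> y = z.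
Proof.
move=> yk zk eyz; have yl := lt_trans yk kl; have zl := lt_trans zk kl.
by have [] := @J_inj (y, y) (z, z) yl yl zl zl eyz.
Qed.

Context (E : set On -> On -> On -> (On -> bool) -> Prop).
Context (E_open : forall c j, cond_open k (E c j)).
Context (E_dense : forall c j, cond_dense k (E c j)).

(* The block s|[al, be) forces E c j, whatever comes before al, for all j < al
   and all c included in a. *)
Definition forcing (a : set On) (al be : On) (s : On -> bool) : Prop :=
  [/\ al <= be, forall z, z < k -> a (e z) -> z < al
    & forall c j t, c `<=` a -> j < al -> E c j be (splice al t s)].

Lemma forcing_anti a a' al be s : a' `<=` a -> forcing a al be s -> forcing a' al be s.
Proof.
move=> aa' [le ae aE]; split=> // [z zk /aa'|c j t ca']; first exact: ae.
by apply: aE => z /ca'/aa'.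
Qed.

Lemma forcing_eq a al be s s' : be < k -> (forall z, z < be -> s' z = s z) ->
  forcing a al be s -> forcing a al be s'.
Proof.
move=> bek ss' [le ae aE]; split=> // c j t ca jal; apply: E_open (aE c j t ca jal) _ _ _ => //.
by move=> z zbe; rewrite /splice ss'.
Qed.

Context (wc : weakly_compact k).

(** There are fewer than [k] triples of a set [c] included in [a], an ordinal [j < al] and a
    sequence [t] in $2^{al}$, so one block can serve them all. *)
Lemma forcing_ex a : small k a -> exists2 al0, al0 < k & forall al, al0 <= al -> al < k ->
  exists be s, be < k /\ forcing a al be s.
Proof.
move=> sa.
have [z []//||al0 al0k al0P] := @small_bounded _ _ _ k_reg [set z | z < k /\ a (e z)].
  by apply: (@small_inj _ _ _ _ _ e _ a) => // [z []|y z [yk _] [zk _]] //; exact: e_inj.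
exists al0 => // al al0al alk.
pose D (p : set On * On * (On -> bool)) b s := E p.1.1 p.1.2 b (splice al p.2 s).
have [|p _|p _|be [s [albe bek _ DD]]] := @cond_dense_forall _ _ On_wo _ k_reg _
  (([set c | c `<=` a] `*` below al) `*` supported al) D _ _ _ al (fun=> false) alk.
- apply: smallX => //; last exact: small_supported.
  by apply: smallX => //; [exact: small_powerset|exact: small_below].
- move=> b s b' s' Db bb' b'k ss'; apply: E_open Db bb' b'k _ => z zb.
  by rewrite /splice ss'.
- move=> b s bk; have mk : Order.max b al < k by rewrite gt_max bk.
  have [b' [x [mb' b'k xs Ex]]] := E_dense p.1.1 p.1.2 (splice al p.2 s) mk.
  exists b', (splice al s x); split=> //.
  + by apply: le_trans mb'; rewrite le_max lexx.
  + move=> z zb; rewrite {1}/splice; case: (ltP z al) => // alz.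
    by rewrite xs ?lt_max ?zb// /splice ltNge alz.
  + apply: E_open Ex _ _ _ => // z _; rewrite /splice; case: (ltP z al) => // zal.
    by rewrite xs ?lt_max ?zal ?orbT// /splice zal.
exists be, s; split=> //; split=> // [z zk aez|c j t ca jal].
  by apply: lt_le_trans al0al; apply: al0P.
(* Only [t] below [al] matters, so it may be cut off there to lie in [supported al]. *)
have -> : splice al t s = splice al (fun z => (z < al) && t z) s.
  by apply/funext => z; rewrite /splice; case: (z < al).
apply: (DD (c, j, fun z => (z < al) && t z)); split=> //= z alz.
by rewrite ltNge alz.
Qed.

Definition blocks : set (On * On * (On -> bool)) :=
  [set p | [/\ p.1.1 < k, p.1.2 < k & supported p.1.2 p.2]].

(** As [k] is a strong limit, three ordinals below [k] code a block, and squares are absorbed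
    twice. *)
Lemma blocks_le : blocks #<= below k.
Proof.
have sq : below k `*` below k #<= below k.
  by apply: card_square_le => //; case: k_reg.
have /choice[i iP] : forall be, exists i : (On -> bool) -> On, be < k ->
    (forall s, supported be s -> i s < k) /\
    (forall s s', supported be s -> supported be s' -> i s = i s' -> s = s').
  move=> be; have [bek|] := pselect (be < k); last by exists (fun=> k).
  have [/(card_le_inj k)[i iP] _] := small_supported On_wo k_reg wc bek.
  by exists i.
apply: (card_le_trans _ sq); apply: card_le_trans (card_le_setX sq (card_lexx _)).
apply: (@inj_card_le_fun _ _ _ _ (fun p => (p.1, i p.1.2 p.2))).
  by move=> p [pk1 pk2 sp]; split=> //; have [+ _] := iP _ pk2; apply.
move=> [[al be] s] [[al' be'] s'] [/= _ bek ss] [/= _ _ ss'] [ealal' ebe].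
by subst be' al' => ee; have [_ /(_ _ _ ss ss' ee) ->] := iP _ bek.
Qed.

(** Unbounded block starts make the set of codes unbounded, since a small set has a small, hence
    bounded, image. *)
Lemma unbounded_image (c : On -> On) (S : set On) : (forall x, S x -> c x < k) ->
  (forall x, x < k -> exists2 y, S y & x <= c y) -> unbounded k S.
Proof.
move=> Sc Su; apply: not_small_unbounded => // sS.
apply: (@unbounded_not_small _ _ _ k_reg (c @` S)).
- by move=> _ [x /Sc xk <-].
- by move=> x /Su[y Sy xy]; exists (c y) => //; exists y.
- exact: small_image.
Qed.

Context (arr : arrow_kk k l (ideal_I k l) k).

Context (code : On -> On * On * (On -> bool)).
Context (codeE : code @` below k = blocks).
(** Start, end and values of the block coded by [x]. *)
Let c1 x := (code x).1.1.
Let c2 x := (code x).1.2.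
Let c3 x := (code x).2.

Let codeP x : x < k -> [/\ c1 x < k, c2 x < k & supported (c2 x) (c3 x)].
Proof. by move=> xk; have : blocks (code x) by rewrite -codeE; exists x. Qed.

Let code_surj al be s : al < k -> be < k -> supported be s ->
  exists2 x, x < k & code x = (al, be, s).
Proof.
move=> alk bek ss; have : blocks (al, be, s) by [].
by rewrite -codeE => -[x xk <-]; exists x.
Qed.

Let pair_color (F : On * On -> bool) B i (FB : forall p, pairs_kk k B p -> F p = i)
  (Fsym : forall x y, F (x, y) = F (y, x)) a b :
  B a -> B b -> trace k a <> trace k b -> F (trace k a, trace k b) = i.
Proof.
move=> Ba Bb; have [lt|lt|//] := ltgtP (trace k a) (trace k b) => _.
  by apply: FB; exists a, b.
by rewrite Fsym; apply: FB; exists b, a.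
Qed.

Let ex_hi (B : set (set On)) a z : positive k l (ideal_I k l) B ->
  a `<=` upper k l -> small k a -> z < k ->
  exists b, [/\ B b, a `<=` hi b & hi b (e z)].
Proof.
move=> /positiveP[Bkl cof] aup sa zk; have [kez ezl] := e_upper zk.
have [|b Bb ab] := cof (a `|` [set e z]).
  apply: PklU => //; last exact: Pkl1.
  by split=> // y /aup[].
exists b; split=> // [y ay|]; last by split=> //; apply: ab; right.
by split; [apply: ab; left|have [] := aup _ ay].
Qed.

(** One [g] must serve all small tags, so that fewer than [k] blocks respecting it start at a given
    place. *)
Definition selecting (g : On -> On) : Prop :=
  forall a, a `<=` upper k l -> small k a -> forall z, z < k ->
  exists al be s, [/\ z <= al, al < k, be < g al & forcing a al be s].

(* Colour 1 marks overlapping blocks: fewer than k blocks allowed by g meet a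
   given one, so a positive set of pairwise disjoint blocks remains, and these
   blocks glue to a single point. *)
Lemma selecting_avoid (g : On -> On) : (forall x, x < k -> g x < k) -> selecting g ->
  exists h : On -> bool, forall c j, c `<=` upper k l -> small k c -> j < k ->
    exists2 be, be < k & E c j be h.
Proof.
move=> gk sel.
pose G a := [set x | [/\ x < k, c2 x < g (c1 x) & forcing a (c1 x) (c2 x) (c3 x)]].
(* [code] need not be injective, so two ordinals with the same block do not count as overlapping. *)
pose ov x y := code x <> code y /\ exists z, [/\ c1 x <= z, z < c2 x, c1 y <= z & z < c2 y].
pose F p := `[< ov p.1 p.2 >].
have Fsym x y : F (x, y) = F (y, x).
  by apply: asbool_equiv_eq; split=> -[ne [z [? ? ? ?]]]; (split; [exact: nesym|exists z]).
have /arr : positive k l (ideal_I k l) [set b | Pkl k l b /\ G (hi b) (trace k b)].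
  apply: positive_of_traces => a aup sa; split; first by move=> x [].
  apply: (@unbounded_image c1) => [x [/codeP[]//]|z zk].
  have [al [be [s [zal alk beg fo]]]] := sel _ aup sa _ zk.
  have bek := lt_trans beg (gk _ alk).
  have [|x xk xE] := @code_surj al be (fun z => (z < be) && s z) alk bek.
    by move=> y bey; rewrite ltNge bey.
  exists x; last by rewrite /c1 xE.
  split=> //; rewrite /c1 /c2 /c3 xE //=.
  by apply: forcing_eq fo => // y ->.
move=> /(_ F)[B [BA [[posB F0]|[ot F1]]]]; last first.
  exfalso; pose S := trace k @` B.
  have Sk : S `<=` below k by move=> _ [b /BA[_ []] + _ _ <-].
  have uS : unbounded k S by exact: order_type_unbounded.
  have Sov x y : S x -> S y -> x <> y -> ov x y.
    by move=> [a Ba <-] [b Bb <-] ne; apply/asboolP; exact: (pair_color F1 Fsym Ba Bb ne).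
  have k0 : exists x, x < k by case: k_reg => _ inf _; exact: infinite_setN0 inf.
  have [x0 x0k] := k0; have [x Sx _] := uS _ x0k; have xk := Sk _ Sx.
  have [_ mk _] := codeP xk.
  apply: (@unbounded_not_small _ _ _ k_reg [set y | S y /\ x < y]).
  - by move=> y [/Sk].
  - exact: unbounded_tail.
  (* A later [y] overlaps the block of [x], so it starts below [c2 x] and ends below [g] of its
     start: fewer than [k] blocks, while [code] is injective on [S]. *)
  apply: (@small_inj _ _ _ _ _ code _ (\bigcup_(al in below (c2 x)) \bigcup_(be in below (g al))
     ((fun s => (al, be, s)) @` supported be))).
  - move=> y [Sy xy]; have [_ [z [_ zx yz zy]]] : ov x y.
      by apply: Sov => // ee; rewrite ee ltxx in xy.
    have [b /BA[_ [yk yg _]] by'] := Sy; rewrite by' in yk yg.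
    exists (c1 y); first exact: le_lt_trans yz zx.
    exists (c2 y) => //; exists (c3 y); first by have [] := codeP yk.
    by rewrite /c1 /c2 /c3; case: (code y) => -[].
  - move=> y z [Sy _] [Sz _] eyz; apply: contrapT => /(Sov _ _ Sy Sz)[]//.
  - apply: small_bigcup => //; first exact: small_below.
    move=> al alm; have gal : g al < k by apply: gk; exact: lt_trans mk.
    apply: small_bigcup => //; first exact: small_below.
    by move=> be beg; apply: small_image; apply: small_supported => //; exact: lt_trans gal.
pose h z := some_of false [set v | exists b, [/\ B b, c1 (trace k b) <= z,
  z < c2 (trace k b) & v = c3 (trace k b) z]].
have hP b z : B b -> c1 (trace k b) <= z -> z < c2 (trace k b) -> h z = c3 (trace k b) z.
  move=> Bb z1 z2.
  have : [set v | exists b, [/\ B b, c1 (trace k b) <= z, z < c2 (trace k b)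
      & v = c3 (trace k b) z]] !=set0 by exists (c3 (trace k b) z), b.
  move=> /(some_ofP false)[b' [Bb' z1' z2']]; rewrite -/(h z) => ->.
  have [eb|ne] := pselect (code (trace k b') = code (trace k b)); first by rewrite /c3 eb.
  have tne : trace k b' <> trace k b by move=> te; apply: ne; rewrite te.
  have : F (trace k b', trace k b) = false by exact: (pair_color F0 Fsym).
  by move=> /asboolPn[]; split=> //; exists z.
exists h => c j cup sc jk.
(* With [e j] in the tag the block of [b] starts above [j] and forces [E c j] whatever [h] does
   before it. *)
have [b [Bb cb bj]] := ex_hi posB cup sc jk.
have [_ [xk _ [le ae aE]]] := BA _ Bb; have [_ bek _] := codeP xk.
exists (c2 (trace k b)) => //; apply: E_open (aE c j h cb (ae _ jk bj)) _ _ _ => // z zbe.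
by rewrite /splice; case: ltP => // zal; exact: hP.
Qed.

(* Colour 1 marks decreasing pairs, so no infinite set is homogeneous for it; on
   a set homogeneous for colour 0 all columns are bounded, by a function g. *)
Lemma selecting_ex : exists2 g, forall x, x < k -> g x < k & selecting g.
Proof.
apply: contrapT => nsel.
(* Only two coordinates of a code matter here: a start, and a strict bound for the end of some
   forcing block, which later yields [be < g al]. *)
pose G a := [set x | x < k /\ exists be s, be < c2 x /\ forcing a (c1 x) be s].
pose inv x y := c1 x < c1 y /\ c2 y < c2 x.
pose F p := `[< inv p.1 p.2 \/ inv p.2 p.1 >].
have Fsym x y : F (x, y) = F (y, x) by apply: asbool_equiv_eq; rewrite /= orC.
have /arr : positive k l (ideal_I k l) [set b | Pkl k l b /\ G (hi b) (trace k b)].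
  apply: positive_of_traces => a aup sa; split; first by move=> x [].
  apply: (@unbounded_image c1) => [x [/codeP[]//]|z zk].
  have [al0 al0k al0P] := forcing_ex sa.
  have mk : Order.max al0 z < k by rewrite gt_max al0k.
  have [|be [s [bek fo]]] := al0P _ _ mk; first by rewrite le_max lexx.
  have [be' be'k bebe'] := below_ltS k_reg bek.
  have [//|x xk xE] := @code_surj _ be' (fun=> false) mk be'k.
  exists x; last by rewrite /c1 xE /= le_max lexx orbT.
  by split=> //; exists be, s; rewrite /c1 /c2 xE.
move=> /(_ F)[B [BA [[posB F0]|[ot F1]]]]; last first.
  pose S := trace k @` B.
  have Sk : S `<=` below k by move=> _ [b /BA[_ []] + _ <-].
  have uS : unbounded k S by exact: order_type_unbounded.
  have Sinv x y : S x -> S y -> x <> y -> inv x y \/ inv y x.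
    by move=> [a Ba <-] [b Bb <-] ne; apply/asboolP; exact: (pair_color F1 Fsym Ba Bb ne).
  have k0 : exists x, x < k by case: k_reg => _ inf _; exact: infinite_setN0 inf.
  have [x0 x0k] := k0; have [x Sx _] := uS _ x0k; have xk := Sk _ Sx.
  have [xk1 xk2 _] := codeP xk.
  apply: (@unbounded_not_small _ _ _ k_reg [set y | S y /\ x < y]).
  - by move=> y [/Sk].
  - exact: unbounded_tail.
  (* Later members have a smaller start or a smaller bound than [x]; members sharing a coordinate
     are never inverted, so each part is small. *)
  apply: (@small_sub _ _ _ _ _ ([set y | S y /\ c1 y < c1 x] `|` [set y | S y /\ c2 y < c2 x])).
    move=> y [Sy xy]; have : x <> y by move=> ee; rewrite ee ltxx in xy.
    by move=> /(Sinv _ _ Sx Sy)[[_ ?]|[? _]]; [right|left].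
  apply: smallU => //.
    apply: (@small_inj _ _ _ _ _ c1 _ (below (c1 x))) => [y []//|y z [Sy _] [Sz _] eyz|].
      by apply: contrapT => /(Sinv _ _ Sy Sz); rewrite /inv eyz ltxx => -[[]|[]].
    exact: small_below.
  apply: (@small_inj _ _ _ _ _ c2 _ (below (c2 x))) => [y []//|y z [Sy _] [Sz _] eyz|].
    by apply: contrapT => /(Sinv _ _ Sy Sz); rewrite /inv eyz ltxx => -[[]|[]].
  exact: small_below.
have nxt al : al < k -> exists2 b, B b & al < c1 (trace k b).
  move=> alk; have [|||b [Bb _ bal]] := @ex_hi B set0 al posB => //.
    exact/small_finite/finite_set0.
  exists b => //; have [_ [_ [be [s [_ [_ ae _]]]]]] := BA _ Bb.
  exact: ae.
have /choice[g gP] : forall al, exists g, al < k -> g < k /\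
    forall b, B b -> c1 (trace k b) = al -> c2 (trace k b) <= g.
  move=> al; have [alk|] := pselect (al < k); last by exists k.
  (* Since [b'] starts after [al], colour 0 forbids a larger bound at start [al], so the bound of
     [b'] serves as the value of [g]. *)
  have [b' Bb' alb'] := nxt _ alk; exists (c2 (trace k b')) => _.
  have [_ [xk' _]] := BA _ Bb'; split; first by have [] := codeP xk'.
  move=> b Bb bal; rewrite leNgt; apply/negP => lt.
  have ne : trace k b <> trace k b' by move=> te; rewrite te ltxx in lt.
  have : F (trace k b, trace k b') = false by exact: (pair_color F0 Fsym).
  by move=> /asboolPn[]; left; split=> //=; rewrite bal.
apply: nsel; exists g => [x /gP[]//|a aup sa z zk].
have [b [Bb ab bz]] := ex_hi posB aup sa zk.
have [_ [xk [be [s [beg fo]]]]] := BA _ Bb; have [c1k _ _] := codeP xk.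
exists (c1 (trace k b)), be, s; split=> //.
- by have [_ ae _] := fo; exact/ltW/ae.
- by apply: lt_le_trans beg _; have [_] := gP _ c1k; apply.
- exact: forcing_anti fo.
Qed.
End Core.

(** * From the relation for pairs of traces to weak compactness and the covering number *)

Section Backward.
Context {d : Order.disp_t} {On : orderType d}.
Context (On_wo : well_order (<=%O : rel On)).
Context (k l : On).
Context (k_reg : regular_cardinal k).
Context (l_card : is_cardinal l).
Context (kl : k < l).
Context (arr : arrow_kk k l (ideal_I k l) k).

(** Colour pairs of traces by [f] on all of $P_k(l)$: in both alternatives the traces form a
    homogeneous set of type [k]. *)
Lemma weakly_compact_of_arrow_kk : weakly_compact k.
Proof.
move=> f; have /arr : positive k l (ideal_I k l) (Pkl k l).
  by apply/positiveP; split=> // a Pa; exists a.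
move=> /(_ (fun p => f p.1 p.2))[B [Bkl H]].
have tk : trace k @` B `<=` below k by move=> _ [b /Bkl/(trace_lt On_wo k_reg) ? <-].
have hom i : (forall p, pairs_kk k B p -> f p.1 p.2 = i) ->
    exists c, forall x y, (trace k @` B) x -> (trace k @` B) y -> x < y -> f x y = c.
  move=> Hi; exists i => _ _ [a Ba <-] [b Bb <-] ab.
  by apply: (Hi (trace k a, trace k b)); exists a, b.
exists (trace k @` B); case: H => [[posB /hom hB]|[ot /hom hB]]; split=> //.
have [_ uB] := positive_traces On_wo k_reg kl posB.
exact: unbounded_order_type.
Qed.

(** Conditions differing from [f] somewhere are dense. Hence the singletons form a meager cover, and
    a least cover exists. *)
Lemma meager_set1 (f : two_pow k) : meager_kk [set f].
Proof.
pose D b x := exists2 z, z < b & x z <> ext f z.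
have oD : cond_open k D.
  move=> b x b' x' [z zb xz] bb' _ xx'; exists z; first exact: lt_le_trans bb'.
  by rewrite xx'.
have dD : cond_dense k D.
  move=> b x bk; have [b' b'k bb'] := below_ltS k_reg bk.
  exists b', (fun z => if z < b then x z else ~~ ext f z); split=> //; first exact: ltW.
    by move=> z ->.
  by exists b => //; rewrite ltxx; case: (ext f b).
exists [set cond_set D]; split.
- by move=> _ ->; split; [exact: cond_set_open|exact: cond_set_dense].
- by exists (cond_set D).
- by have [] := small_finite k_reg (finite_set1 (cond_set D : set (two_pow k))).
- rewrite bigcap_set1; apply/seteqP; split=> // _ [-> [b _ [z _]]]; exact.
Qed.

Lemma lt_pow_lt_cov_of_arrow_kk : lt_pow_lt_cov l k.
Proof.
have wc := weakly_compact_of_arrow_kk.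
have [|Y [Ymeager YT] Ymin] := @card_min (set (two_pow k)) [set Y | meager_cover Y].
  exists [set W | exists f, W = [set f]]; split.
    by move=> _ [f ->]; exact: meager_set1.
  by apply/seteqP; split=> // f _; exists [set f] => //; exists f.
exists Y; split=> //; apply/card_ltNge => Yle.
have Y0 : Y !=set0.
  have : [set: two_pow k] (fun=> true) by [].
  by rewrite -YT => -[W YW _]; exists W.
(* If the cover has at most $l^{<k}$ members, the small tags [c] enumerate it as [W c]. *)
have leY := card_le_trans Yle (lt_pow_le_upper On_wo k_reg l_card kl).
have [W WE] := card_le_surj set0 Y0 leY.
have /choice[X XP] : forall c, exists X : On -> set (two_pow k),
    c `<=` upper k l -> small k c ->
    (forall j, j < k -> open_kk (X j) /\ dense_kk (X j)) /\
    forall f, W c f -> exists2 j, j < k & ~ X j f.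
  move=> c; have [[cup sc]|n] := pselect (c `<=` upper k l /\ small k c); last first.
    by exists (fun=> set0) => cup sc; case: n.
  have /Ymeager[Z [Zod Z0 Zle WZ]] : Y (W c) by rewrite -WE; exists c.
  have [X XE] := card_le_surj set0 Z0 Zle.
  exists X => _ _; split=> [j jk|f Wf].
    by apply: Zod; rewrite -XE; exists j.
  apply: contrapT => n; suff : (set0 : set (two_pow k)) f by [].
  rewrite -WZ; split=> // V; rewrite -XE => -[j jk <-].
  by apply: contrapT => nX; apply: n; exists j.
(* The guards make [E] hold trivially at irrelevant [c] and [j], so it is open and dense for all
   arguments. *)
pose E c j b x := c `<=` upper k l -> small k c -> j < k -> box b x `<=` X c j.
have E_open c j : cond_open k (E c j).
  move=> b x b' x' Eb bb' b'k xx' cup sc jk.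
  exact: open_cond (Eb cup sc jk) bb' b'k xx'.
have E_dense c j : cond_dense k (E c j).
  move=> b x bk; have [[cup sc jk]|n] := pselect [/\ c `<=` upper k l, small k c & j < k].
    have [oX dX] := (XP _ cup sc).1 _ jk.
    have [b' [x' [bb' b'k xx' bX]]] := dense_cond k_reg oX dX x bk.
    by exists b', x'; split=> // _ _ _.
  by exists b, x; split=> // cup sc jk; case: n.
have [J [Jup Jinj]] := pairing_upper On_wo k_reg l_card kl.
have blocks0 : blocks k !=set0.
  have [x xk] : below k !=set0 by case: k_reg => _ inf _; exact: infinite_setN0 inf.
  by exists (x, x, fun=> false).
have [code codeE] := card_le_surj (k, k, fun=> false) blocks0 (blocks_le On_wo k_reg wc).
have [g gk sel] := selecting_ex On_wo k_reg kl Jup Jinj E_open E_dense wc arr codeE.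
have [h hP] := selecting_avoid On_wo k_reg kl Jup E_open wc arr codeE gk sel.
(* The point [res h] lies in every [X c j], hence in no [W c], although these cover the space. *)
have : [set: two_pow k] (res h) by [].
rewrite -YT => -[V]; rewrite -WE => -[c [cup sc] <-] Wh.
have [_ /(_ _ Wh)[j jk nX]] := XP _ cup sc.
have [be bek Eh] := hP _ _ cup sc jk.
by apply: nX; apply: Eh.
Qed.

End Backward.

Theorem corollary13p2 (d : Order.disp_t) (On : orderType d)
    (On_wo : well_order (<=%O : rel On)) (kappa lambda : On)
    (kappa_regular : regular_cardinal kappa)
    (kappa_uncountable : ~ countable (below kappa))
    (lambda_cardinal : is_cardinal lambda)
    (kappa_lt_lambda : kappa < lambda) :
  [<-> weakly_compact kappa /\ lt_pow_lt_cov lambda kappa;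
       arrow_k kappa lambda (ideal_I kappa lambda);
       arrow_kk kappa lambda (ideal_I kappa lambda) kappa].
Proof.
tfae.
- by case; exact: arrow_k_of_cov.
- exact: arrow_kk_of_arrow_k.
- by move=> arr; split; [apply: weakly_compact_of_arrow_kk arr|apply: lt_pow_lt_cov_of_arrow_kk arr].
Qed.
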